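(* Let $\mathcal H$ be a separable real Hilbert space and let $\mathbf A,\mathbf B\in\mathcal B_1^+(\mathcal H)$ with $\mathbf A\leadsto\mathbf B$. Call $\mathbf N_{12}:\mathcal H_2\to\mathcal H_1$ admissible if $\mathcal R(\mathbf N_{12})\subset\mathcal N(\mathbf B_{11}^{1/2}\mathbf A_{11}^{1/2})$ and $\mathbf N_{12}^*\mathbf N_{12}\preceq\mathbf B/\mathbf A$, and let $\boldsymbol\Gamma_t^{\mathbf N_{12}}$ be the associated operators (see context). 1. For every admissible $\mathbf N_{12}$, the path $\boldsymbol\Gamma^{\mathbf N_{12}}:[0,1]\to\mathcal B_1^+(\mathcal H)$, $t\mapsto\boldsymbol\Gamma_t^{\mathbf N_{12}}$, is a constant-speed geodesic, that is, $\mathcal W_2(\boldsymbol\Gamma_s^{\mathbf N_{12}},\boldsymbol\Gamma_t^{\mathbf N_{12}})=(s-t)\,\mathcal W_2(\mathbf A,\mathbf B)$ for any $0\le t\le s\le1$. 2. For any $t\in(0,1)$ and $\boldsymbol\Gamma_t\in\mathcal K_t(\mathbf A,\mathbf B)$, the reverse Schur complements vanish: $\mathbf A/\boldsymbol\Gamma_t=\mathbf 0$ and $\mathbf B/\boldsymbol\Gamma_t=\mathbf 0$. 3. Conversely, any constant-speed geodesic connecting $\mathbf A$ and $\mathbf B$ is of the form $\boldsymbol\Gamma^{\mathbf N_{12}}$ for some admissible $\mathbf N_{12}$.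
   Context: $\mathcal N(\cdot)$ and $\mathcal R(\cdot)$ denote null space and range. $\mathcal B_1^+(\mathcal H)$ is the set of self-adjoint positive semidefinite trace-class operators. $\mathcal W_2^2(\mathbf A,\mathbf B)=\operatorname{tr}\mathbf A+\operatorname{tr}\mathbf B-2\operatorname{tr}(\mathbf A^{1/2}\mathbf B\mathbf A^{1/2})^{1/2}$. $\mathcal K_t(\mathbf A,\mathbf B):=\operatorname*{arg\,min}_{\mathbf C\in\mathcal B_1^+(\mathcal H)}(1-t)\mathcal W_2^2(\mathbf A,\mathbf C)+t\mathcal W_2^2(\mathbf B,\mathbf C)$. A constant-speed geodesic connecting $\mathbf A$ and $\mathbf B$ is a path $\boldsymbol\Gamma:[0,1]\to\mathcal B_1^+(\mathcal H)$ with $\boldsymbol\Gamma_0=\mathbf A$, $\boldsymbol\Gamma_1=\mathbf B$ and $\mathcal W_2(\boldsymbol\Gamma_s,\boldsymbol\Gamma_t)=|s-t|\,\mathcal W_2(\mathbf A,\mathbf B)$. $\mathbf A\leadsto\mathbf B$ means there is a (possibly unbounded) linear operator $\mathbf T:\mathcal R(\mathbf A^{1/2})\subset\overline{\mathcal R(\mathbf A)}\to\mathcal H$ with $(\mathbf T\mathbf A^{1/2})(\mathbf T\mathbf A^{1/2})^*=\mathbf B$ and $\operatorname{tr}(\mathbf A^{1/2}\mathbf T\mathbf A^{1/2})=\operatorname{tr}(\mathbf T\mathbf A)=\operatorname{tr}[(\mathbf A^{1/2}\mathbf B\mathbf A^{1/2})^{1/2}]$. Block notation: $\mathcal H_1=\overline{\mathcal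 R(\mathbf A)}$, $\mathcal H_2=\mathcal N(\mathbf A)$, $\mathbf A_{11}=\mathbf A|_{\mathcal H_1}$, $\mathbf B_{ij}$ the block of $\mathbf B$ from $\mathcal H_j$ to $\mathcal H_i$. $^\dagger$ is the Moore–Penrose pseudoinverse and $\mathbf C^{\dagger/2}:=(\mathbf C^{1/2})^\dagger$. For $\mathbf A,\mathbf B\in\mathcal B_1^+(\mathcal H)$ the Schur complement is $\mathbf B/\mathbf A:=\mathbf B_{22}-(\mathbf B_{11}^{\dagger/2}\mathbf B_{12})^*(\mathbf B_{11}^{\dagger/2}\mathbf B_{12})$ on $\mathcal H_2$; for other pairs (e.g. $\mathbf A/\boldsymbol\Gamma_t$) the same definition is used with the decomposition $\overline{\mathcal R(\boldsymbol\Gamma_t)}\oplus\mathcal N(\boldsymbol\Gamma_t)$. Definition of $\boldsymbol\Gamma_t^{\mathbf N_{12}}$: for admissible $\mathbf N_{12}$ choose any $\mathbf M_{22}:\mathcal H_2\to\mathcal H_2$ with $\mathbf M_{22}\mathbf M_{22}^*=\mathbf B/\mathbf A-\mathbf N_{12}^*\mathbf N_{12}$, set $$\mathbf M=\begin{pmatrix}\mathbf A_{11}^{\dagger/2}(\mathbf A_{11}^{1/2}\mathbf B_{11}\mathbf A_{11}^{1/2})^{1/2}&\mathbf 0\\ [(\mathbf A_{11}^{1/2}\mathbf B_{11}\mathbf A_{11}^{1/2})^{\dagger/2}\mathbf A_{11}^{1/2}\mathbf B_{12}+\mathbf N_{12}]^*&\mathbf M_{22}\end{pmatrix},$$ $\mathbf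 G_t=(1-t)\mathbf A^{1/2}+t\mathbf M$, and $\boldsymbol\Gamma_t^{\mathbf N_{12}}=\mathbf G_t\mathbf G_t^*$; this does not depend on the choice of $\mathbf M_{22}$. *)

(* Defs.v *)
From HB Require Import structures.
From mathcomp Require Import all_boot all_order all_algebra.
From mathcomp Require Import all_classical all_reals all_analysis.

Set Implicit Arguments.
Unset Strict Implicit.
Unset Printing Implicit Defensive.

Import Order.TTheory GRing.Theory Num.Theory.
Import numFieldNormedType.Exports.

Local Open Scope classical_set_scope.
Local Open Scope ring_scope.

HB.mixin Record CompleteNormedModule_isHilbert (R : realType) H
    of CompleteNormedModule R H := {
  inner : {dot H for idfun} ;
  inner_norm : forall x : H, inner x x = `|x| ^+ 2
}.

#[short(type="hilbertType")]
HB.structure Definition Hilbert (R : realType) :=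
  {H of CompleteNormedModule_isHilbert R H & CompleteNormedModule R H}.

Notation "''[' u , v ]" := (inner u v) : ring_scope.

Definition separable (T : topologicalType) : Prop :=
  exists2 D : set T, countable D & dense D.

Section Operators.
Context {R : realType} {H : hilbertType R}.
Implicit Types (A B C S T : H -> H) (V W : set H) (x y : H).

Definition bounded_op T : Prop := linear T /\ continuous T.

Definition null T : set H := [set x | T x = 0].

Definition orth V : set H := [set x | forall v, V v -> '[x, v] = 0].

(* For an everywhere-defined T the adjoint, when it exists, is unique; it exists
   for every bounded T.  The default value is irrelevant. *)
Definition adj T : H -> H :=
  xget (fun=> 0) [set S | forall x y, '[T x, y] = '[x, S y]].

Definition psd_op T : Prop :=
  [/\ bounded_op T,
      forall x y, '[T x, y] = '[x, T y]
    & forall x, 0 <= '[T x, x]].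

Definition loewner_le S T : Prop := psd_op (T - S).

(* The positive semidefinite square root of a positive semidefinite T. *)
Definition sqrt_op T : H -> H :=
  xget (fun=> 0) [set S | psd_op S /\ S \o S = T].

Definition abs_op T : H -> H := sqrt_op (adj T \o T).

(* V is a closed subspace in all uses. *)
Definition proj V x : H := xget 0 [set y | V y /\ orth V (x - y)].

(* Moore-Penrose pseudoinverse of a bounded T, with domain
   range T + orth (range T): pinv T y is the element x of orth (null T) such
   that T x is the orthogonal projection of y on the closure of range T.  It may
   be unbounded; outside of its domain its value is the default 0. *)
Definition pinv T y : H :=
  xget 0 [set x | orth (null T) x /\ orth (range T) (y - T x)].

Definition orthonormal_basis (E : set H) : Prop :=
  (forall x y, E x -> E y -> '[x, y] = (x == y)%:R)
  /\ orth E = [set 0].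

Definition onb : set H := xget set0 orthonormal_basis.

Definition trace_class T : Prop :=
  bounded_op T /\ (\esum_(e in onb) ('[abs_op T e, e])%:E < +oo)%E.

(* The sum over e in onb of '[T e, e], which converges absolutely and does not
   depend on the basis when T is trace class. *)
Definition trace T : R :=
  let d := fun e : H => ('[T e, e])%:E in
  fine (\esum_(e in onb) (d^\+ e)%E - \esum_(e in onb) (d^\- e)%E)%E.

Definition B1plus T : Prop := psd_op T /\ trace_class T.

Definition W2sq A B : R :=
  trace A + trace B - 2 * trace (sqrt_op (sqrt_op A \o B \o sqrt_op A)).

Definition W2 A B : R := Num.sqrt (W2sq A B).

Definition barycenters A B (t : R) : set (H -> H) :=
  let obj := fun C => (1 - t) * W2sq A C + t * W2sq B C in
  [set C | B1plus C /\ forall C', B1plus C' -> obj C <= obj C'].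

Definition constant_speed_geodesic A B (G : R -> H -> H) : Prop :=
  [/\ forall t, 0 <= t <= 1 -> B1plus (G t),
      G 0 = A,
      G 1 = B
    & forall s t, 0 <= s <= 1 -> 0 <= t <= 1 ->
        W2 (G s) (G t) = `|s - t| * W2 A B].

(* Only the restriction of T to range (A^(1/2)) is meaningful.  For an
   everywhere-defined linear X, an everywhere-defined product X X^* forces X to
   be bounded; boundedness of X = T A^(1/2) is stated because adj is a total
   function. *)
Definition reachable A B : Prop :=
  let A2 := sqrt_op A in
  exists T : H -> H,
  [/\ forall (a : R) u v, range A2 u -> range A2 v ->
        T (a *: u + v) = a *: T u + T v,
      bounded_op (T \o A2),
      (T \o A2) \o adj (T \o A2) = B,
      trace (A2 \o T \o A2) = trace (T \o A)
    & trace (T \o A) = trace (sqrt_op (A2 \o B \o A2))].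

(* An operator from a closed subspace W to a closed subspace V is identified
   with its extension to H by 0 on orth W.  The identification is compatible
   with sums, products, adjoints, square roots and pseudoinverses, and a block
   operator is the sum of its blocks. *)
Definition block V W T : H -> H := proj V \o T \o proj W.

Definition op_between W V T : Prop := bounded_op T /\ T = block V W T.

Definition Hone A : set H := closure (range A).
Definition Htwo A : set H := null A.

Definition block11 A T := block (Hone A) (Hone A) T.
Definition block12 A T := block (Hone A) (Htwo A) T.
Definition block22 A T := block (Htwo A) (Htwo A) T.

(* B/A *)
Definition schur B A : H -> H :=
  let K := pinv (sqrt_op (block11 A B)) \o block12 A B in
  block22 A B - (adj K \o K).

(* (A11^(1/2) B11 A11^(1/2))^(1/2) *)
Definition core A B : H -> H :=
  let A112 := sqrt_op (block11 A A) in
  sqrt_op (A112 \o block11 A B \o A112).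

Definition admissible A B (N : H -> H) : Prop :=
  [/\ op_between (Htwo A) (Hone A) N,
      range N `<=` null (sqrt_op (block11 A B) \o sqrt_op (block11 A A))
    & loewner_le (adj N \o N) (schur B A)].

(* Any M22 with M22 M22^* = B/A - N^* N; GammaN does not depend on the choice. *)
Definition M22 A B N : H -> H :=
  xget (fun=> 0) [set M | op_between (Htwo A) (Htwo A) M /\
                          M \o adj M = schur B A - (adj N \o N)].

Definition Mop A B N : H -> H :=
  let A112 := sqrt_op (block11 A A) in
  let M11 := pinv A112 \o core A B in
  let M21 := adj ((pinv (core A B) \o A112 \o block12 A B) + N) in
  M11 + M21 + M22 A B N.

Definition GammaN A B N (t : R) : H -> H :=
  let G := (1 - t) *: sqrt_op A + t *: Mop A B N in
  G \o adj G.

End Operators.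

(* Main.v *)
(* Whenever S = G G^* and T = F F^*, one has W2sq S T <= |G - F|^2 in
   Hilbert-Schmidt norm, with equality iff G^* F is positive semidefinite
   (coupling_defect).  Moreover, for given S and T there always is such an
   optimal F with G = S^(1/2), namely a block operator as in Mop, whose
   restriction to the null space of S is a square root of T/S when N12 = 0.

   Part 1: for G_t = (1 - t) A^(1/2) + t M with A^(1/2) M positive semidefinite,
   all G_s^* G_t are positive semidefinite, so that distances along the path are
   Hilbert-Schmidt distances on a segment.

   Part 2: let S be a barycenter and YA, YB optimal with respect to S^(1/2).
   Comparing S with Z Z^* for Z = (1 - t) YA + t YB, Stewart's identity gives
   S^(1/2) = Z.  On the null space of S this says that a convex combination of
   the square roots of A/S and B/S vanishes.

   Part 3: with S the midpoint of the geodesic, the same identity shows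
   S^(1/2) = (YA + YB) / 2 and that YA^* YB is positive semidefinite.  Applied
   to the triples (Gamma_t, S, B) and (A, S, Gamma_t) it shows that
   Gamma_t = Y_t Y_t^* for Y_t = (1 - t) YA + t YB.  If YA^* = V A^(1/2) is the
   polar decomposition, then N12 is the part of V^* YB^* that the block
   form of Mop does not already prescribe. *)
From HB Require Import structures.
Require Import Defs.
From mathcomp Require Import all_boot all_order all_algebra.
From mathcomp Require Import all_classical all_reals all_analysis.
From mathcomp Require Import ring lra.

Set Implicit Arguments.
Unset Strict Implicit.
Unset Printing Implicit Defensive.

Import Order.TTheory GRing.Theory Num.Theory.
Import numFieldNormedType.Exports.

Local Open Scope classical_set_scope.
Local Open Scope ring_scope.

(** * Inner products *)

(** A factor G of S = G G^* is fixed only up to a partial isometry on the right, while [W2sq] is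
    built from nested square roots. Comparisons are therefore made between factors, in the linear
    space of Hilbert-Schmidt operators, where segments make sense. An optimal factor is always
    produced relative to a square root S^(1/2), and two factors optimal for the same S need not be
    optimal for each other. This is what the midpoint is for: it supplies factors of A and B
    relative to one S^(1/2), and the equality case of Stewart's identity makes them optimal for each
    other. They must then be traded for A^(1/2) and [Mop]. Since G_t G_t^* depends only on YA YA^*,
    YB YB^* and YB YA^*, it suffices to match the last product. Two technical choices follow.
    Unbounded pseudoinverses and polar decompositions are replaced by partial isometries obtained
    from Riesz representation. Trace identities are arranged with nonnegative terms on both sides
    and are checked on each basis vector separately. *)

Section Inner.
Context {R : realType} {H : hilbertType R}.
Implicit Types (x y z u v w : H) (a c : R).
Lemma innerC x y : '[x, y] = '[y, x].
Proof. by rewrite hermC /= expr0 mul1r. Qed.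
Lemma innerDl x y z : '[x + y, z] = '[x, z] + '[y, z].
Proof. exact: linearDl. Qed.
Lemma innerZl a x y : '[a *: x, y] = a * '[x, y].
Proof. rewrite linearZl_LR //=. Qed.
Lemma innerDr x y z : '[x, y + z] = '[x, y] + '[x, z].
Proof. by rewrite innerC innerDl !(innerC x). Qed.
Lemma innerZr a x y : '[x, a *: y] = a * '[x, y].
Proof. by rewrite innerC innerZl innerC. Qed.
Lemma innerNl x y : '[- x, y] = - '[x, y].
Proof. by rewrite -scaleN1r innerZl mulN1r. Qed.
Lemma innerNr x y : '[x, - y] = - '[x, y].
Proof. by rewrite innerC innerNl innerC. Qed.
Lemma innerBl x y z : '[x - y, z] = '[x, z] - '[y, z].
Proof. by rewrite innerDl innerNl. Qed.
Lemma innerBr x y z : '[x, y - z] = '[x, y] - '[x, z].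
Proof. by rewrite innerDr innerNr. Qed.
Lemma inner0l x : '[0, x] = 0.
Proof. by rewrite -(scale0r 0) innerZl mul0r. Qed.
Lemma inner0r x : '[x, 0] = 0.
Proof. by rewrite innerC inner0l. Qed.
Definition innerE := (innerDl, innerDr, innerBl, innerBr, innerZl, innerZr,
  innerNl, innerNr, inner0l, inner0r).
Lemma inner_xx x : '[x, x] = `|x| ^+ 2.
Proof. exact: inner_norm. Qed.

Lemma inner_ge0 x : 0 <= '[x, x].
Proof. by rewrite inner_xx sqr_ge0. Qed.

Lemma inner_eq0 x : '[x, x] = 0 -> x = 0.
Proof. by rewrite inner_xx => /eqP; rewrite sqrf_eq0 normr_eq0 => /eqP. Qed.

Lemma inner_ext x y : (forall z, '[x, z] = '[y, z]) -> x = y.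
Proof.
move=> h; apply/eqP; rewrite -subr_eq0; apply/eqP/inner_eq0.
by rewrite innerBl h subrr.
Qed.

Lemma inner_sqr_le x y : '[x, y] ^+ 2 <= '[x, x] * '[y, y].
Proof.
have [y0|y0] := eqVneq '[y, y] 0.
  by rewrite (inner_eq0 y0) !inner0r expr0n mulr0.
have yp : 0 < '[y, y] by rewrite lt_neqAle eq_sym y0 inner_ge0.
have := inner_ge0 ('[y, y] *: x - '[x, y] *: y).
rewrite !innerE (innerC y x).
rewrite [leRHS](_ : _ = '[y, y] * ('[x, x] * '[y, y] - '[x, y] ^+ 2)); last by ring.
by rewrite pmulr_rge0// subr_ge0.
Qed.

Lemma inner_le_norm x y : `|'[x, y]| <= `|x| * `|y|.
Proof.
rewrite -ler_sqr ?nnegrE ?mulr_ge0// real_normK ?num_real// exprMn -!inner_xx.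
exact: inner_sqr_le.
Qed.

Lemma ler_norm_inner x y : '[x, x] <= '[y, y] -> `|x| <= `|y|.
Proof. by rewrite !inner_xx ler_sqr ?nnegrE. Qed.

Lemma closureP (D : set H) x :
  closure D x <-> forall e, 0 < e -> exists2 d, D d & `|x - d| < e.
Proof.
split=> [cx e e0|h A /nbhs_ballP [e /= e0 eA]].
  by have [d [Dd]] := cx _ (nbhsx_ballx x e e0); rewrite -ball_normE; exists d.
have [d Dd xd] := h _ e0; exists d; split=> //; apply: eA.
by rewrite -ball_normE.
Qed.

Lemma closure_inner (D : set H) x y (c : R) : closure D x ->
  (forall d, D d -> `|'[d, y]| <= c * `|d|) -> `|'[x, y]| <= c * `|x|.
Proof.
move=> /closureP cx h; apply/ler_addgt0Pr => e e0.
(* Replacing [x] by [d] costs at most |y| |x - d| on the left and |c| |x - d| on the right; [k]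
   dominates both, and the 1 keeps it positive. *)
pose k := `|c| + `|y| + 1.
have k0 : 0 < k by rewrite ltr_wpDl ?addr_ge0.
have [d Dd xd] := cx _ (divr_gt0 e0 k0).
have -> : x = d + (x - d) by rewrite addrC subrK.
rewrite innerDl; apply: le_trans (ler_normD _ _) _.
have h1 := h _ Dd; have h2 := inner_le_norm (x - d) y.
have h3 : c * `|d| <= c * `|d + (x - d)| + `|c| * `|x - d|.
  rewrite -lerBlDl -mulrBr; apply: le_trans (ler_norm _) _.
  rewrite normrM ler_wpM2l//; apply: le_trans (ler_dist_dist _ _) _.
  by rewrite opprD addNKr normrN.
have h4 : `|x - d| * k <= e by rewrite -ler_pdivlMr// ltW.
have := normr_ge0 (x - d); rewrite /k in h4; lra.
Qed.

Lemma closure_inner0 (D : set H) x y : closure D x ->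
  (forall d, D d -> '[d, y] = 0) -> '[x, y] = 0.
Proof.
move=> cx h; apply/eqP; rewrite -normr_le0.
rewrite -[leRHS](mul0r `|x|); apply: closure_inner cx _ => d Dd.
by rewrite h// normr0 mul0r.
Qed.

(** Being in the closure of [D], the vector [x] may itself serve as test vector. *)
Lemma closure_self_bound (D : set H) x (c : R) : 0 <= c -> closure D x ->
  (forall d, D d -> `|'[x, d]| <= c * `|d|) -> `|x| <= c.
Proof.
move=> c0 cx h; have [->|x0] := eqVneq x 0; first by rewrite normr0.
have : `|'[x, x]| <= c * `|x|.
  by apply: closure_inner cx _ => d Dd; rewrite innerC h.
by rewrite inner_xx ger0_norm ?sqr_ge0// expr2 ler_pM2r ?normr_gt0.
Qed.
End Inner.

(** * Completeness, boundedness and Riesz representation *)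

Section Complete.
Context {R : realType} {H : hilbertType R}.

Lemma cauchy_lim (u : nat -> H) :
  (forall e : R, 0 < e -> exists N, forall n m, (N <= n)%N -> (N <= m)%N ->
     `|u n - u m| < e) ->
  exists l, forall e : R, 0 < e -> exists N, forall n, (N <= n)%N ->
     `|u n - l| < e.
Proof.
move=> cu.
have /cauchy_cvg/cvg_ex [l ul] : cauchy (u @ \oo).
  apply: cauchy_exP => e e0; have [N hN] := cu _ e0.
  exists (u N), N => // n /= Nn.
  by rewrite -ball_normE /=; apply: hN.
exists l => e e0; move/cvgrPdist_lt : ul => /(_ _ e0) [N _ hN].
by exists N => n Nn; rewrite distrC; apply: hN.
Qed.

Lemma bounded_opP (T : H -> H) : bounded_op T <->
  linear T /\ exists2 c : R, 0 <= c & forall x, `|T x| <= c * `|x|.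
Proof.
split=> -[lT h]; split=> //.
- pose L : {linear H -> H} := HB.pack T (GRing.isLinear.Build _ _ _ _ T lT).
  have /linear_boundedP : bounded_near L (nbhs (0 : H)).
    by apply/linear_bounded_continuous.
  move=> [M [_ hM]]; exists (`|M| + 1); first by rewrite addr_ge0.
  by apply: hM; rewrite (le_lt_trans (ler_norm M))// ltrDl.
- pose L : {linear H -> H} := HB.pack T (GRing.isLinear.Build _ _ _ _ T lT).
  case: h => c c0 h.
  suff : continuous L by [].
  apply/linear_bounded_continuous/linear_boundedP.
  exists c; split; first exact: num_real.
  move=> k ck x; apply: le_trans (h x) _.
  by rewrite ler_wpM2r// ltW.
Qed.
Definition lin_sub (D : set H) :=
  D 0 /\ forall (a : R) u v, D u -> D v -> D (a *: u + v).

Lemma lin_subD D u v : lin_sub D -> D u -> D v -> D (u + v).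
Proof. by move=> [_ h] Du Dv; have := h 1 _ _ Du Dv; rewrite scale1r. Qed.

Lemma lin_subZ D a u : lin_sub D -> D u -> D (a *: u).
Proof. by move=> [D0 h] Du; have := h a _ _ Du D0; rewrite addr0. Qed.

Lemma lin_subB D u v : lin_sub D -> D u -> D v -> D (u - v).
Proof.
by move=> sD Du Dv; apply: lin_subD => //; rewrite -scaleN1r; apply: lin_subZ.
Qed.

(* v is the limit of f along a minimising sequence of ‖f u‖² - 2 g u over D. *)
Lemma riesz (D : set H) (f : H -> H) (g : H -> R) (c : R) :
    lin_sub D -> linear f ->
    (forall a u v, g (a *: u + v) = a * g u + g v) ->
    (forall u, D u -> `|g u| <= c * `|f u|) ->
  exists v, closure (f @` D) v /\ forall u, D u -> '[v, f u] = g u.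
Proof.
move=> sD lf lg bg.
pose J u := '[f u, f u] - 2 * g u.
have JE (a : R) u v : J (a *: u + v) =
    J v + 2 * a * ('[f v, f u] - g u) + a ^+ 2 * '[f u, f u].
  by rewrite /J lf lg !innerE (innerC (f u) (f v)); ring.
have Jlb u : D u -> - c ^+ 2 <= J u.
  move=> Du; rewrite /J inner_xx.
  have := bg _ Du; rewrite ler_norml => /andP[_ h].
  have := sqr_ge0 (`|f u| - c); nra.
have hinf : has_inf (J @` D).
  by split; [exists (J 0), 0 => //; exact: sD.1 | exists (- c ^+ 2) => _ [u Du <-]; exact: Jlb].
pose m := inf (J @` D).
have mJ u : D u -> m <= J u by move=> Du; apply: ge_inf; [exact: hinf.2 | exists u].
have /choice [u hu] : forall n : nat, exists u, D u /\ J u < m + n.+1%:R^-1.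
  move=> n; have e0 : 0 < n.+1%:R^-1 :> R by rewrite invr_gt0 ltr0n.
  by have [_ [u Du <-] ?] := inf_adherent e0 hinf; exists u.
(* Parallelogram law: [J] at the midpoint of [u n] and [u k] is at least [m], so the excess of the
   two values over [m] controls the distance. *)
have fuC n k : '[f (u n) - f (u k), f (u n) - f (u k)] <=
     2 * n.+1%:R^-1 + 2 * k.+1%:R^-1.
  have := mJ _ (lin_subZ (2^-1) sD (lin_subD sD (hu n).1 (hu k).1)).
  have -> : 2^-1 *: (u n + u k) = 2^-1 *: u n + 2^-1 *: u k by rewrite scalerDr.
  rewrite JE -[2^-1 *: u k]addr0 JE.
  have lf0 : f 0 = 0 by have := lf (-1) 0 0; rewrite scaleN1r oppr0 addr0 scaleN1r addNr.
  have lg0 : g 0 = 0 by have := lg (-1) 0 0; rewrite scaleN1r oppr0 addr0 mulN1r addNr.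
  have := (hu n).2; have := (hu k).2; rewrite /J !lf lf0 lg0.
  rewrite !innerE !(innerC (f (u k)) (f (u n))).
  move: (k.+1%:R^-1) (n.+1%:R^-1) => ek en; lra.
have small (e : R) : 0 < e -> exists N, forall n, (N <= n)%N -> n.+1%:R^-1 < e.
  move=> e0; exists (Num.truncn e^-1) => n Nn.
  rewrite -[ltRHS]invrK ltf_pV2 ?posrE ?invr_gt0 ?ltr0n//.
  by apply: lt_le_trans (truncnS_gt _) _; rewrite ler_nat ltnS.
have [v hv] : exists l, forall e : R, 0 < e -> exists N, forall n, (N <= n)%N ->
     `|f (u n) - l| < e.
  apply: cauchy_lim => e e0.
  have [|N hN] := small (e ^+ 2 / 4); first by rewrite divr_gt0 ?exprn_gt0.
  exists N => n k Nn Nk.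
  suff : `|f (u n) - f (u k)| ^+ 2 < e ^+ 2 by rewrite ltr_sqr ?nnegrE// ltW.
  rewrite -inner_xx; apply: le_lt_trans (fuC n k) _.
  have := hN _ Nn; have := hN _ Nk.
  move: (k.+1%:R^-1) (n.+1%:R^-1) => ek en; lra.
exists v; split.
  apply/closureP => e /hv [N hN]; exists (f (u N)); first by exists (u N) => //; exact: (hu N).1.
  by rewrite distrC hN.
move=> w Dw.
(* The limit [v] need not be a value of [f], so the first-order inequality is written at [u n] and
   passed to the limit. *)
have key a : 0 <= 2 * a * ('[v, f w] - g w) + a ^+ 2 * '[f w, f w].
  apply/ler_addgt0Pr => e e0.
  pose d := 2 * `|a| * `|f w| + 1.
  have d0 : 0 < d by rewrite /d ltr_wpDl ?mulr_ge0.
  have [N1 hN1] := hv _ (divr_gt0 e0 (mulr_gt0 (ltr0Sn R 1) d0)).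
  have [N2 hN2] := small _ (divr_gt0 e0 (ltr0Sn R 1)).
  pose n := maxn N1 N2.
  have h1 := hN1 n (leq_maxl _ _); have h2 := hN2 n (leq_maxr _ _).
  have [Dn Jn] := hu n.
  have := mJ _ (sD.2 a _ _ Dw Dn); rewrite JE => h3.
  have h4 : a * '[f (u n), f w] <= a * '[v, f w] + `|a| * (`|f (u n) - v| * `|f w|).
    rewrite -lerBlDl -mulrBr -innerBl; apply: le_trans (ler_norm _) _.
    by rewrite normrM ler_wpM2l// inner_le_norm.
  have h5 : 2 * `|a| * `|f w| * `|f (u n) - v| <= e / 2.
    have : `|f (u n) - v| * d <= e / 2.
      rewrite -ler_pdivlMr//; apply: ltW; apply: lt_le_trans h1 _.
      by rewrite le_eqVlt; apply/orP; left; apply/eqP; field; rewrite gt_eqF.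
    by have := normr_ge0 (f (u n) - v); rewrite /d; lra.
  move: (n.+1%:R^-1) h2 Jn => en h2 Jn; lra.
apply/eqP; rewrite -subr_eq0; set k := _ - _ in key *; set q := '[f w, f w] in key.
have q0 : 0 <= q by exact: inner_ge0.
(* The minimizing parameter would be [- k / q]; the denominator [q + 1] also covers [q = 0] and
   still gives a negative value unless [k = 0]. *)
have := key (- k / (q + 1)).
have -> : 2 * (- k / (q + 1)) * k + (- k / (q + 1)) ^+ 2 * q =
   - (k ^+ 2 * ((q + 2) / (q + 1) ^+ 2)) by field; rewrite gt_eqF// ltr_wpDl.
rewrite oppr_ge0 pmulr_lle0; last by rewrite divr_gt0 ?exprn_gt0// ltr_wpDl.
by move=> h; rewrite -sqrf_eq0 eq_le h sqr_ge0.
Qed.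
End Complete.

(** * Bounded operators, adjoints, projections *)

Section Bounded.
Context {R : realType} {H : hilbertType R}.
Local Notation proj := Defs.proj.
Implicit Types (x y z u v w : H) (a c : R) (S T A B X Y : H -> H) (V W : set H).

Lemma bopL T : bounded_op T -> linear T. Proof. by case. Qed.

Lemma bopD T x y : bounded_op T -> T (x + y) = T x + T y.
Proof. by move=> [h _]; have := h 1 x y; rewrite !scale1r. Qed.

Lemma bop0 T : bounded_op T -> T 0 = 0.
Proof.
by move=> [h _]; have := h (-1) 0 0; rewrite scaleN1r oppr0 addr0 scaleN1r addNr.
Qed.

Lemma bopZ T a x : bounded_op T -> T (a *: x) = a *: T x.
Proof. by move=> bT; have := bopL bT a x 0; rewrite !addr0 bop0// addr0. Qed.

Lemma bopN T x : bounded_op T -> T (- x) = - T x.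
Proof. by move=> bT; rewrite -scaleN1r bopZ// scaleN1r. Qed.

Lemma bopB T x y : bounded_op T -> T (x - y) = T x - T y.
Proof. by move=> bT; rewrite bopD// bopN. Qed.

Lemma bop_le T : bounded_op T -> exists2 c, 0 <= c & forall x, `|T x| <= c * `|x|.
Proof. by move/bounded_opP => []. Qed.

Lemma bop_intro T c : (forall a x y, T (a *: x + y) = a *: T x + T y) ->
  (forall x, `|T x| <= c * `|x|) -> bounded_op T.
Proof.
move=> lT bT; apply/bounded_opP; split=> //; exists `|c| => // x.
by apply: le_trans (bT x) _; rewrite ler_wpM2r// ler_norm.
Qed.

Lemma bop_cst0 : bounded_op (0 : H -> H).
Proof.
apply: (@bop_intro _ 0) => [a x y|x]; first by rewrite /= scaler0 addr0.
by rewrite normr0 mul0r.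
Qed.

Lemma bop_comp S T : bounded_op S -> bounded_op T -> bounded_op (S \o T).
Proof.
move=> bS bT; have [c c0 hc] := bop_le bS; have [d d0 hd] := bop_le bT.
apply: (@bop_intro _ (c * d)) => [a x y|x] /=.
  by rewrite (bopL bT) (bopL bS).
by apply: le_trans (hc _) _; rewrite -mulrA ler_wpM2l.
Qed.

Lemma bop_add S T : bounded_op S -> bounded_op T -> bounded_op (S + T).
Proof.
move=> bS bT; have [c c0 hc] := bop_le bS; have [d d0 hd] := bop_le bT.
apply: (@bop_intro _ (c + d)) => [a x y|x].
  by rewrite !addrfctE (bopL bT) (bopL bS) scalerDr addrACA.
by rewrite addrfctE mulrDl (le_trans (ler_normD _ _))// lerD.
Qed.

Lemma bop_scale a T : bounded_op T -> bounded_op (a *: T).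
Proof.
move=> bT; have [d d0 hd] := bop_le bT.
apply: (@bop_intro _ (`|a| * d)) => [b x y|x].
  by rewrite !scalrfctE (bopL bT) scalerDr !scalerA mulrC.
by rewrite scalrfctE normrZ -mulrA ler_wpM2l.
Qed.

Lemma bop_opp T : bounded_op T -> bounded_op (- T).
Proof. by move=> bT; rewrite -scaleN1r; apply: bop_scale. Qed.

Lemma bop_sub S T : bounded_op S -> bounded_op T -> bounded_op (S - T).
Proof. by move=> bS bT; apply: bop_add => //; exact: bop_opp. Qed.

Lemma bop_id : bounded_op (idfun : H -> H).
Proof. by apply: (@bop_intro _ 1) => // x; rewrite mul1r. Qed.

Lemma adj_uniq T S : (forall x y, '[T x, y] = '[x, S y]) -> adj T = S.
Proof.
move=> h; rewrite /adj; case: xgetP => [U _ /= hU|hn]; last first.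
  by case: (hn S).
apply/funext => y; apply: inner_ext => z.
by rewrite innerC -hU h innerC.
Qed.

Lemma adjP T : bounded_op T -> forall x y, '[T x, y] = '[x, adj T y].
Proof.
move=> bT; suff [S hS] : exists S, forall x y, '[T x, y] = '[x, S y].
  by rewrite (adj_uniq hS).
have /choice [S hS] : forall y, exists z, forall x, '[T x, y] = '[x, z].
  move=> y; have [c c0 hc] := bop_le bT.
  have [|||| z [_ hz]] := @riesz _ _ setT (idfun : H -> H) (fun x => '[T x, y]) (c * `|y|).
  - by split.
  - by [].
  - by move=> a u v; rewrite bopD// bopZ// !innerE.
  - move=> u _ /=; apply: le_trans (inner_le_norm _ _) _.
    by rewrite mulrAC ler_wpM2r.
  by exists z => x; rewrite -(hz x)//= innerC.
by exists S => x y; rewrite hS.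
Qed.

Lemma adjP' T : bounded_op T -> forall x y, '[adj T x, y] = '[x, T y].
Proof. by move=> bT x y; rewrite innerC -adjP// innerC. Qed.

Lemma norm_adj_le T c : 0 <= c -> bounded_op T ->
  (forall x, `|T x| <= c * `|x|) -> forall x, `|adj T x| <= c * `|x|.
Proof.
move=> c0 bT hc x; have [->|n0] := eqVneq (adj T x) 0.
  by rewrite normr0 mulr_ge0.
have np : 0 < `|adj T x| by rewrite normr_gt0.
rewrite -(ler_pM2r np) -expr2 -inner_xx -adjP//.
apply: le_trans (ler_norm _) _; apply: le_trans (inner_le_norm _ _) _.
by rewrite mulrAC ler_wpM2r.
Qed.

Lemma bop_adj T : bounded_op T -> bounded_op (adj T).
Proof.
move=> bT; have [c c0 hc] := bop_le bT.
apply: (@bop_intro _ c); last exact: norm_adj_le.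
move=> a x y; apply: inner_ext => z.
by rewrite !innerE !adjP'// !innerE.
Qed.

Lemma adjK T : bounded_op T -> adj (adj T) = T.
Proof. by move=> bT; apply: adj_uniq => x y; rewrite adjP'. Qed.

Lemma adj_compE S T : bounded_op S -> bounded_op T ->
  adj (S \o T) = adj T \o adj S.
Proof. by move=> bS bT; apply: adj_uniq => x y /=; rewrite !adjP. Qed.

Lemma adj_addE S T : bounded_op S -> bounded_op T -> adj (S + T) = adj S + adj T.
Proof.
by move=> bS bT; apply: adj_uniq => x y; rewrite !addrfctE !innerE !adjP.
Qed.

Lemma adj_scaleE a T : bounded_op T -> adj (a *: T) = a *: adj T.
Proof.
by move=> bT; apply: adj_uniq => x y; rewrite !scalrfctE !innerE !adjP.
Qed.

Definition csub V := lin_sub V /\ closure V `<=` V.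

Lemma lin_sub_orth V : lin_sub (orth V).
Proof.
split=> [v _|a u v hu hv w Vw]; first by rewrite inner0l.
by rewrite !innerE hu// hv// mulr0 addr0.
Qed.

Lemma csub_orth V : csub (orth V).
Proof.
split=> [|x cx v Vv]; first exact: lin_sub_orth.
by apply: closure_inner0 cx _ => d; apply.
Qed.

Lemma lin_sub_closure V : lin_sub V -> lin_sub (closure V).
Proof.
move=> sV; split; first by apply: subset_closure; exact: sV.1.
move=> a u v /closureP cu /closureP cv; apply/closureP => e e0.
have k0 : 0 < `|a| + 1 by rewrite ltr_wpDl.
have e2 : 0 < e / 2 by rewrite divr_gt0.
have [d Vd ud] := cu _ (divr_gt0 e2 k0).
have [d' Vd' vd] := cv _ e2.
exists (a *: d + d'); first exact: sV.2.
rewrite opprD addrACA -scalerBr (le_lt_trans (ler_normD _ _))// [ltRHS]splitr.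
apply: ler_ltD => //; rewrite normrZ.
have : `|u - d| * (`|a| + 1) <= e / 2 by rewrite -ler_pdivlMr// ltW.
by have := normr_ge0 (u - d); lra.
Qed.

Lemma csub_closure V : lin_sub V -> csub (closure V).
Proof.
move=> sV; split; first exact: lin_sub_closure.
by move=> x; rewrite -(closure_id (closure V)).1//; exact: closed_closure.
Qed.

Lemma lin_sub_range T : bounded_op T -> lin_sub (range T).
Proof.
move=> bT; split; first by exists 0; rewrite ?bop0.
by move=> a _ _ [u _ <-] [v _ <-]; exists (a *: u + v); rewrite ?(bopL bT).
Qed.

Lemma orth_closure V : orth (closure V) = orth V.
Proof.
apply/seteqP; split=> x hx v Vv; first by apply: hx; exact: subset_closure.
by rewrite innerC; apply: closure_inner0 Vv _ => d Vd; rewrite innerC hx.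
Qed.

Lemma null_orth T : bounded_op T -> null T = orth (range (adj T)).
Proof.
move=> bT; apply/seteqP; split=> [x /= Tx _ [y _ <-]|x hx].
  by rewrite -adjP// Tx inner0l.
by apply: inner_eq0; rewrite adjP// hx//; exists (T x).
Qed.

Lemma csub_null T : bounded_op T -> csub (null T).
Proof. by move=> bT; rewrite null_orth//; exact: csub_orth. Qed.

Lemma orth_self V x : V x -> orth V x -> x = 0.
Proof. by move=> Vx ox; apply: inner_eq0; apply: ox. Qed.

Lemma proj_uniq V x y : csub V -> V y -> orth V (x - y) -> proj V x = y.
Proof.
move=> [sV cV] Vy oy; rewrite /proj; case: xgetP => [z _ [Vz oz]|hn]; last first.
  by case: (hn y).
apply/eqP; rewrite -subr_eq0; apply/eqP.
apply: (@orth_self V); first exact: lin_subB.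
have -> : z - y = (x - y) - (x - z).
  by apply: inner_ext => t; rewrite !innerE; ring.
exact: (lin_subB (lin_sub_orth V)).
Qed.

Lemma projP V x : csub V -> V (proj V x) /\ orth V (x - proj V x).
Proof.
move=> cV; suff [y Vy oy] : exists2 y, V y & orth V (x - y).
  by rewrite (proj_uniq cV Vy oy).
have [|||| y [cy hy]] := @riesz _ _ V (idfun : H -> H) (fun u => '[x, u]) `|x|.
- exact: cV.1.
- by [].
- by move=> a u v; rewrite !innerE.
- by move=> u _ /=; exact: inner_le_norm.
exists y; first by apply: cV.2; move: cy; rewrite image_id.
by move=> v Vv; rewrite innerBl -(hy v)//= subrr.
Qed.

Lemma proj_in V x : csub V -> V (proj V x).
Proof. by move=> cV; case: (projP x cV). Qed.

Lemma proj_orth V x : csub V -> orth V (x - proj V x).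
Proof. by move=> cV; case: (projP x cV). Qed.

Lemma proj_sym V x y : csub V -> '[proj V x, y] = '[x, proj V y].
Proof.
move=> cV; have h1 := proj_orth x cV (proj_in y cV).
have h2 := proj_orth y cV (proj_in x cV).
move: h1 h2; rewrite !innerBl => /subr0_eq -> /subr0_eq.
by rewrite innerC => ->; rewrite innerC.
Qed.

Lemma proj_id V x : csub V -> V x -> proj V x = x.
Proof.
move=> cV Vx; apply: proj_uniq => //; rewrite subrr; exact: (lin_sub_orth V).1.
Qed.

Lemma proj_eq0 V x : csub V -> orth V x -> proj V x = 0.
Proof. by move=> cV ox; apply: proj_uniq; rewrite ?subr0//; exact: cV.1.1. Qed.

Lemma bop_proj V : csub V -> bounded_op (proj V).
Proof.
move=> cV; apply: (@bop_intro _ 1) => [a x y|x].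
  by apply: inner_ext => z; rewrite !innerE !proj_sym// !innerE.
rewrite mul1r; apply: ler_norm_inner.
rewrite proj_sym// (proj_id cV); last exact: proj_in.
have := proj_orth x cV (proj_in x cV); have := inner_ge0 (x - proj V x).
rewrite !innerE (innerC (proj V x) x); lra.
Qed.

Lemma adj_proj V : csub V -> adj (proj V) = proj V.
Proof. by move=> cV; apply: adj_uniq => x y; rewrite proj_sym. Qed.

Lemma orth_orth V x : lin_sub V -> orth (orth V) x -> closure V x.
Proof.
move=> sV ox; have cV := csub_closure sV.
have := proj_orth x cV; rewrite orth_closure => h.
suff <- : proj (closure V) x = x by exact: proj_in.
apply/eqP; rewrite eq_sym -subr_eq0; apply/eqP/(@orth_self (orth V)) => //.
apply: (lin_subB (lin_sub_orth (orth V))) => // v vo.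
rewrite innerC; rewrite -orth_closure in vo; apply: vo; exact: proj_in.
Qed.

(** Continuity enters through the adjoint: pairing with the fixed vector [adj X z] passes to
    closures. The typical [X] is [adj W \o W] minus the identity. *)
Lemma comp_eq0_orth X Y x : bounded_op X -> (forall u, X (Y u) = 0) ->
  closure (range Y) x -> X x = 0.
Proof.
move=> bX XY cx; apply: inner_ext => z; rewrite inner0l adjP//.
by apply: closure_inner0 cx _ => _ [u _ <-]; rewrite -adjP// XY inner0l.
Qed.

Lemma quad_ext S T : bounded_op S -> bounded_op T ->
  (forall x y, '[S x, y] = '[x, S y]) -> (forall x y, '[T x, y] = '[x, T y]) ->
  (forall x, '[S x, x] = '[T x, x]) -> S = T.
Proof.
move=> bS bT sS sT h; apply/funext => x; apply: inner_ext => z.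
have := h (x + z); rewrite !bopD// !innerE !h (sS z x) (sT z x).
by rewrite (innerC z (S x)) (innerC z (T x)); lra.
Qed.

End Bounded.

(** * Square roots and partial isometries *)

Section Sqrt.
Context {R : realType} {H : hilbertType R}.
Implicit Types (x y z u v w : H) (a c : R) (S T A B X Y : H -> H) (V W : set H).

Lemma psd_bop T : psd_op T -> bounded_op T. Proof. by case. Qed.

Lemma psd_sym T x y : psd_op T -> '[T x, y] = '[x, T y].
Proof. by case. Qed.

Lemma psd_ge0 T x : psd_op T -> 0 <= '[T x, x]. Proof. by case. Qed.

Lemma psd_adj T : psd_op T -> adj T = T.
Proof. by move=> [_ sT _]; apply: adj_uniq. Qed.

Lemma psd_inner_sqr_le T x y : psd_op T ->
  '[T x, y] ^+ 2 <= '[T x, x] * '[T y, y].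
Proof.
move=> pT; have bT := psd_bop pT.
have E a : 0 <= '[T x, x] + 2 * a * '[T x, y] + a ^+ 2 * '[T y, y].
  have := psd_ge0 (x + a *: y) pT; rewrite bopD// bopZ// !innerE.
  by rewrite (psd_sym y x pT) (innerC y) => h; apply: le_trans h _; lra.
have hx := psd_ge0 x pT; have hy := psd_ge0 y pT.
have [y0|y0] := eqVneq '[T y, y] 0.
  rewrite y0 mulr0; have [->|n0] := eqVneq '[T x, y] 0; first by rewrite expr0n.
  (* When the form vanishes at [y], [E] is affine in its parameter; this value makes the right-hand
     side equal to -1. *)
  have := E (- ('[T x, x] + 1) / (2 * '[T x, y])); rewrite y0 mulr0 addr0.
  have -> : 2 * (- ('[T x, x] + 1) / (2 * '[T x, y])) * '[T x, y] =
    - ('[T x, x] + 1) by field.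
  lra.
have yp : 0 < '[T y, y] by rewrite lt_neqAle eq_sym y0.
have := E (- '[T x, y] / '[T y, y]).
have -> : '[T x, x] + 2 * (- '[T x, y] / '[T y, y]) * '[T x, y] +
  (- '[T x, y] / '[T y, y]) ^+ 2 * '[T y, y] =
  ('[T x, x] * '[T y, y] - '[T x, y] ^+ 2) / '[T y, y] by field.
by rewrite pmulr_lge0 ?invr_gt0// subr_ge0.
Qed.

Lemma psd_eq0 T x : psd_op T -> '[T x, x] = 0 -> T x = 0.
Proof.
move=> pT h; have := psd_inner_sqr_le x (T x) pT; rewrite h mul0r => h'.
apply: inner_eq0; apply/eqP; rewrite -sqrf_eq0 eq_le h' sqr_ge0//.
Qed.

(** Cauchy-Schwarz for the form of [T] at [x] and [T x] bounds |T x|^4 by |x|^2 |T x|^2. *)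
Lemma psd_contract T : psd_op T -> (forall x, '[T x, x] <= '[x, x]) ->
  forall x, `|T x| <= `|x|.
Proof.
move=> pT h x; apply: ler_norm_inner.
have [->|n0] := eqVneq (T x) 0; first by rewrite inner0l inner_ge0.
have Tp : 0 < '[T x, T x] by rewrite inner_xx exprn_gt0// normr_gt0.
rewrite -(ler_pM2r Tp); apply: (le_trans (psd_inner_sqr_le x (T x) pT)).
by apply: ler_pM; rewrite ?psd_ge0.
Qed.

Lemma psd_comp_adj X : bounded_op X -> psd_op (X \o adj X).
Proof.
move=> bX; split; first exact: (bop_comp bX (bop_adj bX)).
  by move=> x y /=; rewrite adjP// -(adjP' bX).
by move=> x /=; rewrite adjP// inner_ge0.
Qed.

Lemma psd_adj_comp X : bounded_op X -> psd_op (adj X \o X).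
Proof. by move=> bX; have := psd_comp_adj (bop_adj bX); rewrite adjK. Qed.

Lemma psd_conj T X : psd_op T -> bounded_op X -> psd_op (adj X \o T \o X).
Proof.
move=> pT bX; have bT := psd_bop pT; split.
- by apply: bop_comp => //; apply: bop_comp => //; exact: bop_adj.
- by move=> x y /=; rewrite (adjP' bX) psd_sym// (adjP bX).
- by move=> x /=; rewrite (adjP' bX); exact: psd_ge0.
Qed.

Section contraction.
Variable A : H -> H.
Hypothesis pA : psd_op A.
Hypothesis A1 : forall x, '[A x, x] <= '[x, x].

(* With X = 1 - A the fixed point Y of Y = (X + Y^2) / 2 gives (1 - Y)^2 = A.
   The iterates started at 0 are dominated in norm, as are their increments, by
   the scalar iteration for X = 1; hence they converge without any use of
   monotone convergence of operators. *)
Fixpoint sqrt_seq (n : nat) : H -> H :=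
  if n is m.+1 then fun x => 2^-1 *: ((x - A x) + sqrt_seq m (sqrt_seq m x)) else 0.

Fixpoint sqrt_bound (n : nat) : R :=
  if n is m.+1 then 2^-1 * (1 + sqrt_bound m ^+ 2) else 0.

Local Notation Y := sqrt_seq.
Local Notation b := sqrt_bound.

Lemma sqrt_bound_ge0 n : 0 <= b n.
Proof. by case: n => //= n; rewrite mulr_ge0// addr_ge0// sqr_ge0. Qed.

Lemma sqrt_bound_le1 n : b n <= 1.
Proof. by elim: n => //= n IH; have := sqrt_bound_ge0 n; nra. Qed.

Lemma sqrt_bound_homo n m : (n <= m)%N -> b n <= b m.
Proof.
have h k : b k <= b k.+1.
  elim: k => [|k IH]; first by rewrite /= expr0n addr0 mulr1.
  rewrite [leLHS]/(2^-1 * _) [leRHS]/(2^-1 * (1 + b k.+1 ^+ 2)).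
  by rewrite ler_pM2l// lerD2l// ler_sqr ?nnegrE ?sqrt_bound_ge0.
by move=> nm; apply: (homo_leq (fun=> lexx _) le_trans h).
Qed.

Let X x := x - A x.

Let X_le x : `|X x| <= `|x|.
Proof.
have pX : psd_op X.
  split; first by apply: bop_sub; [exact: bop_id|exact: psd_bop].
    by move=> u v; rewrite /X !innerE psd_sym.
  by move=> u; rewrite /X innerBl subr_ge0.
apply: psd_contract => // u; rewrite /X innerBl gerBl; exact: psd_ge0.
Qed.

Let bA := psd_bop pA.

Lemma bop_sqrt_seq n : bounded_op (Y n).
Proof.
elim: n => [|n IH] /=; first exact: bop_cst0.
apply: (bop_scale 2^-1 (T := fun x => (x - A x) + Y n (Y n x))).
apply: bop_add; last exact: bop_comp.
by apply: bop_sub => //; exact: bop_id.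
Qed.

Lemma sqrt_seq_le n x : `|Y n x| <= b n * `|x|.
Proof.
elim: n x => [|n IH] x /=; first by rewrite normr0 mul0r.
rewrite normrZ ger0_norm// -mulrA ler_pM2l// mulrDl mul1r.
apply: le_trans (ler_normD _ _) _; apply: lerD; first exact: X_le.
apply: le_trans (IH _) _; rewrite expr2 -mulrA ler_wpM2l//.
exact: sqrt_bound_ge0.
Qed.

Lemma sqrt_seq_step n x : `|Y n.+1 x - Y n x| <= (b n.+1 - b n) * `|x|.
Proof.
elim: n x => [|n IH] x.
  rewrite /= !subr0 expr0n !addr0 mulr1 normrZ ger0_norm// ler_pM2l//.
  exact: X_le.
(* A difference of squares split without commuting the factors. The scalar difference of squares
   factors in the same way, so the two bounds match exactly. *)
have -> : Y n.+2 x - Y n.+1 x =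
  2^-1 *: (Y n.+1 (Y n.+1 x - Y n x) + (Y n.+1 (Y n x) - Y n (Y n x))).
  rewrite (bopB _ _ (bop_sqrt_seq _)).
  have YS k : Y k.+1 x = 2^-1 *: (X x + Y k (Y k x)) by [].
  rewrite (YS n.+1) (YS n).
  by apply: inner_ext => z; rewrite !innerE; ring.
rewrite normrZ ger0_norm//.
have -> : b n.+2 - b n.+1 = 2^-1 * (b n.+1 ^+ 2 - b n ^+ 2) by rewrite /=; ring.
rewrite -mulrA ler_pM2l//; apply: le_trans (ler_normD _ _) _.
have h1 := sqrt_seq_le n.+1 (Y n.+1 x - Y n x).
have h2 := IH (Y n x).
have h3 := sqrt_seq_le n x; have h4 := IH x.
have h5 := sqrt_bound_ge0 n.+1.
have h6 : 0 <= b n.+1 - b n by rewrite subr_ge0 sqrt_bound_homo.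
have h7 := ler_wpM2l h5 h4; have h8 := ler_wpM2l h6 h3.
apply: le_trans (lerD (le_trans h1 h7) (le_trans h2 h8)) _.
by rewrite le_eqVlt; apply/orP; left; apply/eqP; ring.
Qed.

Lemma sqrt_seq_dist n m x : (n <= m)%N -> `|Y m x - Y n x| <= (b m - b n) * `|x|.
Proof.
move=> /subnK <-; elim: (m - n)%N => [|k IH]; first by rewrite add0n !subrr normr0 mul0r.
rewrite addSn.
have -> : Y (k + n).+1 x - Y n x =
  (Y (k + n).+1 x - Y (k + n)%N x) + (Y (k + n)%N x - Y n x).
  by rewrite addrA subrK.
apply: le_trans (ler_normD _ _) _; apply: le_trans (lerD (sqrt_seq_step _ _) IH) _.
by rewrite le_eqVlt; apply/orP; left; apply/eqP; ring.
Qed.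

Let s := sup (range b).

Let has_sup_b : has_sup (range b).
Proof.
split; first by exists (b 0%N), 0%N.
by exists 1 => _ [n _ <-]; exact: sqrt_bound_le1.
Qed.

Let b_le n : b n <= s.
Proof. by apply: ub_le_sup; [exact: has_sup_b.2|exists n]. Qed.

(** [s - b n] is the common rate of convergence: an identity between limits follows once its defect
    is a fixed multiple of this rate. *)
Let b_small c (r : R) : (forall n, `|r| <= c * (s - b n)) -> r = 0.
Proof.
move=> h; apply/eqP; rewrite -normr_le0; apply/ler_addgt0Pr => e e0; rewrite add0r.
have k0 : 0 < `|c| + 1 by rewrite ltr_wpDl.
have [_ [n _ <-] hn] := sup_adherent (divr_gt0 e0 k0) has_sup_b.
have {}hn : (s - b n) * (`|c| + 1) <= e.
  by rewrite -ler_pdivlMr//; move: hn; rewrite -/s; lra.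
have d0 : 0 <= s - b n by rewrite subr_ge0.
by apply: le_trans (h n) _; have := ler_wpM2r d0 (ler_norm c); lra.
Qed.

Let lim_ex x : exists l, forall n, `|Y n x - l| <= (s - b n) * `|x|.
Proof.
have [l hl] : exists l, forall e : R, 0 < e -> exists N, forall n, (N <= n)%N ->
     `|Y n x - l| < e.
  apply: cauchy_lim => e e0.
  have k0 : 0 < `|x| + 1 by rewrite ltr_wpDl.
  have [_ [N _ <-] hN] := sup_adherent (divr_gt0 e0 k0) has_sup_b.
  exists N; suff h n m : (N <= n)%N -> (n <= m)%N -> `|Y m x - Y n x| < e.
    move=> n m Nn Nm; case/orP: (leq_total n m) => nm; last exact: h.
    by rewrite distrC; exact: h.
  move=> Nn nm; apply: le_lt_trans (sqrt_seq_dist x nm) _.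
  have {}hN : (s - b N) * (`|x| + 1) < e.
    by rewrite -ltr_pdivlMr//; move: hN; rewrite -/s; lra.
  have h1 := b_le m; have h2 := sqrt_bound_homo Nn; have h3 := normr_ge0 x.
  have h4 := sqrt_bound_homo nm.
  have : (b m - b n) * `|x| <= (s - b N) * `|x| by rewrite ler_wpM2r//; lra.
  by have := b_le N; nra.
exists l => n; apply/ler_addgt0Pr => e e0; have [N hN] := hl _ e0.
pose m := maxn n N; have h1 := hN m (leq_maxr _ _).
have h2 := sqrt_seq_dist x (leq_maxl n N).
have -> : Y n x - l = (Y m x - l) - (Y m x - Y n x) by apply: inner_ext => z; rewrite !innerE; ring.
apply: le_trans (ler_normB _ _) _; rewrite addrC; apply: lerD; last exact: ltW.
by apply: le_trans h2 _; rewrite ler_wpM2r// lerD2r b_le.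
Qed.

(** The commutation clause is what later gives uniqueness: any root of [A] commutes with [A], hence
    with this [S]. *)
Lemma sqrt_contraction : exists S, [/\ psd_op S, S \o S = A &
  forall T, bounded_op T -> (forall x, T (A x) = A (T x)) ->
    forall x, T (S x) = S (T x)].
Proof.
have /choice [L hL] := lim_ex.
have d0 n : 0 <= s - b n by rewrite subr_ge0 b_le.
have veq x y c : (forall n, `|x - y| <= c * (s - b n)) -> x = y.
  move=> h; apply/eqP; rewrite -subr_eq0 -normr_eq0; apply/eqP/(b_small (c := c)).
  by move=> n; rewrite normr_id.
have L1 x : `|L x| <= `|x|.
  rewrite -subr_le0; apply/ler_addgt0Pr => e e0; rewrite add0r.
  have k0 : 0 < `|x| + 1 by rewrite ltr_wpDl.
  have [_ [n _ <-] hn] := sup_adherent (divr_gt0 e0 k0) has_sup_b.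
  have {}hn : (s - b n) * (`|x| + 1) <= e.
    by rewrite -ler_pdivlMr//; move: hn; rewrite -/s; lra.
  have h1 := hL x n; have h2 := sqrt_seq_le n x; have h3 := sqrt_bound_le1 n.
  have : `|L x| <= `|Y n x| + `|Y n x - L x|.
    by rewrite -{1}(subKr (Y n x) (L x)) ler_normB.
  have := d0 n; have := normr_ge0 x; nra.
have bL : bounded_op L.
  apply: (@bop_intro _ _ _ 1) => [a x y|x]; last by rewrite mul1r.
  apply: (veq _ _ (`|a *: x + y| + `|a| * `|x| + `|y|)) => n.
  have -> : L (a *: x + y) - (a *: L x + L y) =
    - (Y n (a *: x + y) - L (a *: x + y)) + a *: (Y n x - L x) + (Y n y - L y).
    rewrite (bopD _ _ (bop_sqrt_seq n)) (bopZ _ _ (bop_sqrt_seq n)).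
    by apply: inner_ext => z; rewrite !innerE; ring.
  apply: le_trans (ler_normD _ _) _.
  apply: le_trans (lerD (ler_normD _ _) (lexx _)) _.
  rewrite normrN normrZ.
  have h1 := hL (a *: x + y) n; have h2 := hL x n; have h3 := hL y n.
  have := ler_wpM2l (normr_ge0 a) h2; lra.
have Ysym n x y : '[Y n x, y] = '[x, Y n y].
  elim: n x y => [|n IH] x y /=; first by rewrite inner0l inner0r.
  by rewrite !innerE !IH (psd_sym _ _ pA).
have sL x y : '[L x, y] = '[x, L y].
  apply/eqP; rewrite -subr_eq0; apply/eqP/(b_small (c := 2 * `|x| * `|y|)) => n.
  have -> : '[L x, y] - '[x, L y] = - '[Y n x - L x, y] + '[x, Y n y - L y].
    by rewrite !innerE Ysym; ring.
  apply: le_trans (ler_normD _ _) _; rewrite normrN.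
  apply: le_trans (lerD (inner_le_norm _ _) (inner_le_norm _ _)) _.
  have := ler_wpM2r (normr_ge0 y) (hL x n).
  have := ler_wpM2l (normr_ge0 x) (hL y n); lra.
(* Limit of the doubled recursion. The quadratic term is replaced one factor at a time, using that
   each [Y n] is a contraction. *)
have fixL x : L x + L x = X x + L (L x).
  apply: (veq _ _ (3 * `|x| + `|L x|)) => n.
  have -> : L x + L x - (X x + L (L x)) =
    - (Y n.+1 x - L x) - (Y n.+1 x - L x) + Y n (Y n x - L x) +
    (Y n (L x) - L (L x)).
    rewrite (bopB _ _ (bop_sqrt_seq n)) /=.
    by apply: inner_ext => z; rewrite /X !innerE; field.
  apply: le_trans (ler_normD _ _) _.
  apply: le_trans (lerD (ler_normD _ _) (lexx _)) _.
  apply: le_trans (lerD (lerD (ler_normD _ _) (lexx _)) (lexx _)) _.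
  rewrite !normrN.
  have h1 : `|Y n.+1 x - L x| <= (s - b n) * `|x|.
    apply: le_trans (hL x n.+1) _; rewrite ler_wpM2r// lerB//.
    exact: sqrt_bound_homo.
  have h2 := hL x n; have h3 := hL (L x) n.
  have h4 : `|Y n (Y n x - L x)| <= `|Y n x - L x|.
    apply: le_trans (sqrt_seq_le _ _) _; rewrite -[leRHS]mul1r ler_wpM2r//.
    exact: sqrt_bound_le1.
  lra.
exists (fun x => x - L x); split.
- split.
  + by apply: bop_sub => //; exact: bop_id.
  + by move=> x y; rewrite !innerE sL.
  + move=> x; rewrite innerBl subr_ge0; apply: le_trans (ler_norm _) _.
    apply: le_trans (inner_le_norm _ _) _.
    by rewrite inner_xx expr2 ler_wpM2r.
- apply/funext => x /=; rewrite bopB//.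
  have -> : x - L x - (L x - L (L x)) = (x + L (L x)) - (L x + L x).
    by apply: inner_ext => z; rewrite !innerE; ring.
  by rewrite fixL /X; apply: inner_ext => z; rewrite !innerE; ring.
- move=> T bT TA x; rewrite bopB//; congr (_ - _).
  have TY n u : T (Y n u) = Y n (T u).
    elim: n u => [|n IH] u /=; first by rewrite bop0.
    by rewrite (bopZ _ _ bT) (bopD _ _ bT) (bopB _ _ bT) TA !IH.
  have [c c0 hc] := bop_le bT.
  apply: (veq _ _ (c * `|x| + `|T x|)) => n.
  have -> : T (L x) - L (T x) = - T (Y n x - L x) + (Y n (T x) - L (T x)).
    by rewrite (bopB _ _ bT) TY; apply: inner_ext => z; rewrite !innerE; ring.
  apply: le_trans (ler_normD _ _) _; rewrite normrN.
  have h1 := le_trans (hc _) (ler_wpM2l c0 (hL x n)); have h2 := hL (T x) n; lra.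
Qed.

End contraction.

Lemma sqrt_exists A : psd_op A -> exists S, [/\ psd_op S, S \o S = A &
  forall T, bounded_op T -> (forall x, T (A x) = A (T x)) ->
    forall x, T (S x) = S (T x)].
Proof.
move=> pA; have bA := psd_bop pA; have [c0 c00 hc] := bop_le bA.
(* Scaling by [c] brings the form of [A] below the identity; the added 1 keeps [c] positive when the
   bound [c0] is 0. *)
pose c := c0 + 1; have cp : 0 < c by rewrite /c ltr_wpDl.
have pcA : psd_op (c^-1 *: A).
  split; first exact: bop_scale.
    by move=> x y; rewrite !scalrfctE !innerE psd_sym.
  by move=> x; rewrite scalrfctE innerZl mulr_ge0 ?psd_ge0// invr_ge0 ltW.
have [x|S [pS SS cS]] := sqrt_contraction pcA.
  rewrite scalrfctE innerZl mulrC ler_pdivrMr//.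
  apply: le_trans (ler_norm _) _; apply: le_trans (inner_le_norm _ _) _.
  rewrite inner_xx expr2 mulrAC ler_wpM2r// mulrC; apply: le_trans (hc x) _.
  by rewrite ler_wpM2r// /c lerDl.
have sc : 0 <= Num.sqrt c by exact: sqrtr_ge0.
have bS := psd_bop pS.
exists (Num.sqrt c *: S); split.
- split; first exact: bop_scale.
    by move=> x y; rewrite !scalrfctE !innerE psd_sym.
  by move=> x; rewrite scalrfctE innerZl mulr_ge0 ?psd_ge0.
- apply/funext => x /=; rewrite !scalrfctE (bopZ _ _ bS) scalerA -expr2.
  have -> : S (S x) = (S \o S) x by [].
  by rewrite SS sqr_sqrtr ?ltW// scalrfctE scalerA divff ?gt_eqF// scale1r.
- move=> T bT TA x; rewrite !scalrfctE (bopZ _ _ bT) cS// => y.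
  by rewrite !scalrfctE (bopZ _ _ bT) TA.
Qed.

(* With d = S x - T x, commutation gives (S + T) d = 0. *)
Lemma psd_commute_sqr_inj S T : psd_op S -> psd_op T -> S \o S = T \o T ->
  (forall x, S (T x) = T (S x)) -> S = T.
Proof.
move=> pS pT ST cST; have bS := psd_bop pS; have bT := psd_bop pT.
have SST x : S (S x) = T (T x) by have := congr1 (fun f : H -> H => f x) ST.
apply/funext => x; pose d := S x - T x.
have Sd : S d + T d = 0.
  by rewrite /d (bopB _ _ bS) (bopB _ _ bT) SST cST addrA subrK subrr.
have := congr1 (fun v => '[v, d]) Sd; rewrite innerDl inner0l => h.
have hS := psd_ge0 d pS; have hT := psd_ge0 d pT.
have S0 : S d = 0 by apply: psd_eq0 => //; lra.
have T0 : T d = 0 by apply: psd_eq0 => //; lra.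
apply/eqP; rewrite -subr_eq0; apply/eqP/inner_eq0; rewrite -/d.
by rewrite {1}/d innerBl (psd_sym _ _ pS) (psd_sym _ _ pT) S0 T0 subrr.
Qed.

Lemma psd_sqr T : psd_op T -> psd_op (T \o T).
Proof. by move=> pT; have := psd_comp_adj (psd_bop pT); rewrite psd_adj. Qed.

(** [S] and [T] are not known to commute with each other. Both are compared with the root [U] from
    [sqrt_exists], which commutes with whatever commutes with [T \o T], in particular with every
    root of it. *)
Lemma psd_sqr_inj S T : psd_op S -> psd_op T -> S \o S = T \o T -> S = T.
Proof.
move=> pS pT ST; have [U [pU UU cU]] := sqrt_exists (psd_sqr pT).
have E (V : H -> H) : psd_op V -> V \o V = T \o T -> V = U.
  move=> pV VV; apply: psd_commute_sqr_inj => //; first by rewrite UU.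
  apply: cU; first exact: psd_bop.
  by move=> x; rewrite -VV.
by rewrite (E S)// (E T).
Qed.

Lemma sqrt_uniq A S : psd_op S -> S \o S = A -> sqrt_op A = S.
Proof.
move=> pS SS; rewrite /sqrt_op; case: xgetP => [T _ [pT TT]|h]; last first.
  by case: (h S).
by apply: psd_sqr_inj => //; rewrite SS TT.
Qed.

Lemma psd_sqrt A : psd_op A -> psd_op (sqrt_op A).
Proof. by move=> pA; have [S [pS SS _]] := sqrt_exists pA; rewrite (sqrt_uniq pS SS). Qed.

Lemma sqrt_sqr A : psd_op A -> sqrt_op A \o sqrt_op A = A.
Proof. by move=> pA; have [S [pS SS _]] := sqrt_exists pA; rewrite (sqrt_uniq pS SS). Qed.

Lemma sqrtK A x : psd_op A -> sqrt_op A (sqrt_op A x) = A x.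
Proof. by move=> pA; have := congr1 (fun f : H -> H => f x) (sqrt_sqr pA). Qed.

Lemma sqrt_inner A x y : psd_op A -> '[sqrt_op A x, sqrt_op A y] = '[A x, y].
Proof.
by move=> pA; rewrite -(psd_sym _ _ (psd_sqrt pA)) sqrtK.
Qed.

Lemma null_sqrt A : psd_op A -> null (sqrt_op A) = null A.
Proof.
move=> pA; apply/seteqP; split=> x /= h.
  by rewrite /null /= -(sqrtK x pA) h bop0//; exact: psd_bop (psd_sqrt pA).
by apply: inner_eq0; rewrite (sqrt_inner _ _ pA) h inner0l.
Qed.

Lemma abs_op_psd T : psd_op T -> abs_op T = T.
Proof. by move=> pT; rewrite /abs_op psd_adj//; apply: sqrt_uniq. Qed.

Lemma null_psd_orth T : psd_op T -> null T = orth (range T).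
Proof. by move=> pT; rewrite null_orth ?psd_adj//; exact: psd_bop. Qed.

End Sqrt.

Section PartialIsometry.
Context {R : realType} {H : hilbertType R}.
Implicit Types (x y z u v w : H) (a c : R) (S T A B X Y : H -> H) (V W : H -> H).

Lemma quad_polar X Y : bounded_op X -> bounded_op Y ->
  (forall u, '[X u, X u] = '[Y u, Y u]) ->
  forall u v, '[X u, X v] = '[Y u, Y v].
Proof.
move=> bX bY h u v; have := h (u + v).
rewrite (bopD _ _ bX) (bopD _ _ bY) !innerE !h (innerC (X v)) (innerC (Y v)); lra.
Qed.

(** The polar factor of [X] relative to [Y]. The last field encodes that it vanishes off the closure
    of [range Y]. Both contraction bounds are kept, because estimates for a composition with [W] on
    the right go through [adj W]. *)
Record partial_isometry X Y W : Prop := PartialIsometry {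
  pi_bop : bounded_op W;
  pi_fwd : forall u, W (Y u) = X u;
  pi_bwd : forall u, adj W (X u) = Y u;
  pi_le : forall u, '[W u, W u] <= '[u, u];
  pi_adj_le : forall u, '[adj W u, adj W u] <= '[u, u];
  pi_adj_range : forall u, closure (range Y) (adj W u)
}.

Arguments pi_adj_range {X Y W}.

(* W u is the element of the closure of range X with <W u, X v> = <u, Y v>. *)
Lemma partial_isometry_exists X Y : bounded_op X -> bounded_op Y ->
  (forall u, '[X u, X u] = '[Y u, Y u]) -> exists W, partial_isometry X Y W.
Proof.
move=> bX bY h; have XY := quad_polar bX bY h.
have Xn u : `|X u| = `|Y u|.
  by apply/eqP; rewrite eq_le !ler_norm_inner// h.
have /choice [W hW] : forall w, exists v, closure (range X) v /\
    forall u, '[v, X u] = '[w, Y u].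
  move=> w; have [|||| v [cv hv]] := @riesz _ _ setT X (fun u => '[w, Y u]) `|w|.
  - by split.
  - exact: bopL.
  - by move=> a u v; rewrite (bopL bY) !innerE.
  - by move=> u _; rewrite Xn; exact: inner_le_norm.
  by exists v; split=> // u; exact: hv.
have ext v w : closure (range X) v -> closure (range X) w ->
    (forall u, '[v, X u] = '[w, X u]) -> v = w.
  move=> cv cw hvw; apply/eqP; rewrite -subr_eq0; apply/eqP.
  apply: (@orth_self _ _ (closure (range X))).
    exact: (lin_subB (lin_sub_closure (lin_sub_range bX)) cv cw).
  by rewrite orth_closure => _ [u _ <-]; rewrite innerBl hvw subrr.
have WY u : W (Y u) = X u.
  apply: ext; [exact: (hW _).1 | by apply: subset_closure; exists u |].
  by move=> v; rewrite (hW _).2 XY.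
have W1 u : `|W u| <= `|u|.
  apply: (closure_self_bound (D := range X)) => //; first exact: (hW u).1.
  move=> _ [v _ <-]; rewrite (hW u).2 Xn; exact: inner_le_norm.
have bW : bounded_op W.
  apply: (@bop_intro _ _ _ 1) => [a x y|x]; last by rewrite mul1r.
  have sX := lin_sub_closure (lin_sub_range bX).
  apply: ext; [exact: (hW _).1 | by apply: sX.2; exact: (hW _).1 |].
  by move=> u; rewrite !innerE !(hW _).2 !innerE.
have WX u : adj W (X u) = Y u.
  by apply: inner_ext => z; rewrite innerC -adjP// (hW z).2 innerC.
exists W; split=> //.
- move=> u; rewrite !inner_xx ler_sqr ?nnegrE//.
- move=> u; rewrite !inner_xx ler_sqr ?nnegrE// -[leRHS]mul1r.
  by apply: norm_adj_le => // x; rewrite mul1r.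
- move=> u; apply: orth_orth; first exact: lin_sub_range.
  move=> z oz; rewrite adjP'//.
  suff -> : W z = 0 by rewrite inner0r.
  apply: ext; [exact: (hW _).1 | apply: (lin_sub_closure (lin_sub_range bX)).1 |].
  by move=> v; rewrite (hW _).2 inner0l oz//; exists v.
Qed.

Section facts.
Variables X Y W : H -> H.
Hypothesis pW : partial_isometry X Y W.

Lemma pi_eq0 z : orth (range Y) z -> W z = 0.
Proof.
move=> oz; have bW := pi_bop pW; apply: inner_ext => u; rewrite inner0l adjP//.
rewrite innerC; apply: closure_inner0 (pi_adj_range pW u) _ => d Dd.
by rewrite innerC; exact: oz.
Qed.

Lemma pi_compl z : closure (range Y) z -> adj W (W z) = z.
Proof.
move=> cz; apply/eqP; rewrite -subr_eq0; apply/eqP.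
have bW := pi_bop pW; have bW' := bop_adj bW.
have bD := bop_sub (bop_comp bW' bW) (bop_id (H := H)).
apply: (comp_eq0_orth bD _ cz) => u.
by rewrite /= [LHS](_ : _ = adj W (W (Y u)) - Y u)// (pi_fwd pW) (pi_bwd pW) subrr.
Qed.

End facts.
End PartialIsometry.
Arguments pi_adj_range {R H X Y W}.

(** * Orthonormal bases, traces and Hilbert-Schmidt norms *)

Section OrthonormalBasis.
Context {R : realType} {H : hilbertType R}.
Local Notation proj := Defs.proj.
Implicit Types (x y z u v w : H) (s : seq H) (E : set H).

Let on E := forall x y, E x -> E y -> '[x, y] = (x == y)%:R :> R.

Lemma onb_exists : exists E : set H, orthonormal_basis E.
Proof.
have [F FP totF|E [onE maxE]] := @Zorn_bigcup H on.
  move=> x y [X FX Xx] [Y FY Yy]; have [XY|YX] := totF _ _ FX FY.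
    by apply: (FP _ FY) => //; exact: XY.
  by apply: (FP _ FX) => //; exact: YX.
exists E; split=> //; apply/seteqP; split=> [x ox|_ ->]; last exact: (lin_sub_orth E).1.
apply: contrapT => /eqP x0.
have nx0 : `|x| != 0 by rewrite normr_eq0.
pose u := `|x|^-1 *: x.
have ou v : E v -> '[u, v] = 0 by move=> Ev; rewrite innerZl ox// mulr0.
have uu : '[u, u] = 1 by rewrite innerZl innerZr inner_xx; field.
apply: (maxE (E `|` [set u])).
  split=> [v Ev|Eu]; first by left.
  have /Eu Euu : (E `|` [set u]) u by right.
  by have := ou _ Euu; rewrite uu => /eqP; rewrite oner_eq0.
have neq v : E v -> u != v.
  move=> Ev; apply/eqP => uv; rewrite -uv in Ev.
  by have := ou _ Ev; rewrite uu => /eqP; rewrite oner_eq0.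
move=> y z [Ey|->] [Ez|->].
- exact: onE.
- by rewrite innerC ou// eq_sym (negbTE (neq _ Ey)).
- by rewrite ou// (negbTE (neq _ Ez)).
- by rewrite uu eqxx.
Qed.

Lemma onbP : orthonormal_basis (onb : set H).
Proof.
rewrite /onb; case: xgetP => // h; have [E hE] := onb_exists.
by case: (h E).
Qed.

Lemma onb_inner x y : onb x -> onb y -> '[x, y] = (x == y)%:R.
Proof. exact: onbP.1. Qed.

Lemma inner_suml s (F : H -> H) y :
  '[\sum_(e <- s) F e, y] = \sum_(e <- s) '[F e, y].
Proof.
by apply: (big_morph (fun u => '[u, y])) => [u v|]; rewrite ?innerDl ?inner0l.
Qed.

Lemma onb_sum_inner s x e : uniq s -> (forall e, e \in s -> onb e) -> e \in s ->
  '[\sum_(f <- s) '[x, f] *: f, e] = '[x, e].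
Proof.
move=> us sE es; rewrite inner_suml (bigD1_seq e)//= innerZl.
rewrite (onb_inner (sE _ es) (sE _ es)) eqxx mulr1 big1_seq ?addr0// => f /andP[fe fs].
by rewrite innerZl (onb_inner (sE _ fs) (sE _ es)) (negbTE fe) mulr0.
Qed.

(** The hypothesis on [z] says, by duality, that [z] lies in the span of [s]; the left-hand side is
    the squared distance from [x] to that span. *)
Lemma bessel_dist s x z : uniq s -> (forall e, e \in s -> onb e) ->
  (forall w, (forall e, e \in s -> '[w, e] = 0) -> '[w, z] = 0) ->
  '[x, x] - \sum_(e <- s) '[x, e] ^+ 2 <= '[x - z, x - z].
Proof.
move=> us sE hz; pose y := \sum_(f <- s) '[x, f] *: f.
have xye e : e \in s -> '[x - y, e] = 0.
  by move=> es; rewrite innerBl onb_sum_inner// subrr.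
have xyz := hz _ xye.
have xyy : '[x - y, y] = 0.
  rewrite innerC inner_suml big1_seq// => e /andP[_ es].
  by rewrite innerZl (innerC _ (x - y)) xye// mulr0.
have yy : '[x, y] = \sum_(e <- s) '[x, e] ^+ 2.
  rewrite innerC inner_suml; apply: eq_bigr => e _.
  by rewrite innerZl (innerC _ x) expr2.
have := inner_ge0 (y - z); rewrite -yy; move: xyz xyy.
by rewrite !innerE (innerC z x) (innerC z y); lra.
Qed.

Lemma bessel s x : uniq s -> (forall e, e \in s -> onb e) ->
  \sum_(e <- s) '[x, e] ^+ 2 <= '[x, x].
Proof.
move=> us sE; pose y := \sum_(f <- s) '[x, f] *: f.
have yx : '[x, y] = \sum_(e <- s) '[x, e] ^+ 2.
  rewrite innerC inner_suml; apply: eq_bigr => e _.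
  by rewrite innerZl (innerC _ x) expr2.
have yy : '[y, y] = \sum_(e <- s) '[x, e] ^+ 2.
  rewrite {1}/y inner_suml; apply: eq_big_seq => e es.
  by rewrite innerZl (innerC _ y) onb_sum_inner// expr2.
have := inner_ge0 (x - y); rewrite !innerE (innerC y x) yy yx; lra.
Qed.

Lemma parseval x : (\esum_(e in onb) ('[x, e] ^+ 2)%:E = ('[x, x])%:E)%E.
Proof.
apply/eqP; rewrite eq_le; apply/andP; split.
  apply: ge_ereal_sup => _ [X [finX XE] <-].
  rewrite fsbig_finite// sumEFin lee_fin; apply: bessel; first exact: finmap.fset_uniq.
  by move=> e; rewrite in_fset_set// inE; exact: XE.
(* Lists with possible repetitions make sums a concatenation; duplicates are removed only when
   [bessel_dist] is applied. *)
pose D := [set z : H | exists l : seq (R * H), (forall p, p \in l -> onb p.2) /\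
  z = \sum_(p <- l) p.1 *: p.2].
have sD : lin_sub D.
  split; first by exists [::]; rewrite big_nil.
  move=> a _ _ [l [lE ->]] [l' [lE' ->]].
  exists ([seq (a * p.1, p.2) | p <- l] ++ l'); split.
    move=> p; rewrite mem_cat => /orP[/mapP[q ql ->]/=|]; last exact: lE'.
    exact: lE.
  rewrite big_cat big_map scaler_sumr /=; congr (_ + _).
  by apply: eq_bigr => p _; rewrite scalerA.
have DE e : onb e -> D e.
  move=> Ee; exists [:: (1, e)]; split=> [p|]; first by rewrite inE => /eqP ->.
  by rewrite big_seq1 scale1r.
have cx : closure D x.
  have cD := csub_closure sD.
  suff <- : proj (closure D) x = x by exact: proj_in.
  apply/eqP; rewrite eq_sym -subr_eq0; apply/eqP.
  have : orth onb (x - proj (closure D) x).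
    move=> e Ee; apply: (proj_orth x cD); apply: subset_closure; exact: DE.
  by rewrite onbP.2.
apply/lee_addgt0Pr => e e0.
have k0 : 0 < Num.sqrt e by rewrite sqrtr_gt0.
have [z [l [lE zE]] xz] := (closureP _ _).1 cx _ k0.
pose s := undup (map snd l).
have sE f : f \in s -> onb f by rewrite mem_undup => /mapP[p pl ->]; exact: lE.
have hs := bessel_dist (s := s) x (z := z) (undup_uniq _) sE.
have {}hs : '[x, x] - \sum_(f <- s) '[x, f] ^+ 2 <= e.
  apply: le_trans (hs _) _.
    move=> w hw; rewrite innerC zE.
    have -> : '[\sum_(p <- l) p.1 *: p.2, w] = \sum_(p <- l) '[p.1 *: p.2, w].
      by apply: (big_morph (fun u => '[u, w])) => [u v|]; rewrite ?innerDl ?inner0l.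
    rewrite big1_seq// => p /andP[_ pl]; rewrite innerZl (innerC _ w) hw ?mulr0//.
    by rewrite mem_undup; apply/mapP; exists p.
  rewrite inner_xx -[leRHS](sqr_sqrtr (ltW e0)) ler_sqr ?nnegrE ?sqrtr_ge0//.
  exact: ltW.
apply: (@le_trans _ _ ((\sum_(f <- s) '[x, f] ^+ 2)%:E + e%:E)%E).
  by rewrite -EFinD lee_fin; lra.
rewrite leeD2r//; apply: esum_ge; exists [set` s].
  by split; [exact: finite_seq | move=> f /sE].
by rewrite -fsbig_seq ?undup_uniq// sumEFin.
Qed.

End OrthonormalBasis.

Section HilbertSchmidt.
Context {R : realType} {H : hilbertType R}.
Implicit Types (x y z u v w : H) (f g : H -> R) (a : R) (T X Y W : H -> H).

Definition onb_sum f : \bar R := (\esum_(e in onb) (f e)%:E)%E.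

(** Nonnegativity is included so that sums are additive without any discussion of convergence.
    Differences are handled by moving terms to the other side. *)
Definition onb_summable f := (forall e, 0 <= f e) /\ (onb_sum f < +oo)%E.

Definition onb_fsum f : R := fine (onb_sum f).

Lemma onb_sum_ge0 f : (forall e, 0 <= f e) -> (0 <= onb_sum f)%E.
Proof. by move=> f0; apply: esum_ge0 => e _; rewrite lee_fin. Qed.

Lemma onb_sumE f : onb_summable f -> onb_sum f = (onb_fsum f)%:E.
Proof.
move=> [f0 fo]; rewrite /onb_fsum fineK// ge0_fin_numE//; exact: onb_sum_ge0.
Qed.

Lemma onb_fsum_ge0 f : (forall e, 0 <= f e) -> 0 <= onb_fsum f.
Proof. by move=> f0; rewrite /onb_fsum fine_ge0// onb_sum_ge0. Qed.

Lemma onb_sumD f g : (forall e, 0 <= f e) -> (forall e, 0 <= g e) ->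
  onb_sum (fun e => f e + g e) = (onb_sum f + onb_sum g)%E.
Proof.
move=> f0 g0; rewrite /onb_sum -esumD => [|e _|e _]; rewrite ?lee_fin//.
Qed.

Lemma onb_summableD f g : onb_summable f -> onb_summable g ->
  onb_summable (fun e => f e + g e).
Proof.
move=> sf sg; split=> [e|]; first by rewrite addr_ge0 ?sf.1 ?sg.1.
by rewrite onb_sumD ?onb_sumE// ?ltry//; [exact: sf.1|exact: sg.1].
Qed.

Lemma onb_fsumD f g : onb_summable f -> onb_summable g ->
  onb_fsum (fun e => f e + g e) = onb_fsum f + onb_fsum g.
Proof.
move=> sf sg; apply: EFin_inj; rewrite -onb_sumE; last exact: onb_summableD.
by rewrite onb_sumD ?EFinD ?onb_sumE//; [exact: sf.1|exact: sg.1].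
Qed.

Lemma onb_sum_le f g : (forall e, f e <= g e) -> (onb_sum f <= onb_sum g)%E.
Proof. by move=> fg; apply: le_esum => e _; rewrite lee_fin. Qed.

Lemma onb_summable_le f g : (forall e, 0 <= f e <= g e) -> onb_summable g ->
  onb_summable f.
Proof.
move=> fg [g0 go]; split=> [e|]; first by have /andP[] := fg e.
by apply: le_lt_trans go; apply: onb_sum_le => e; have /andP[] := fg e.
Qed.

Lemma onb_sumZ_le f a : 0 <= a -> onb_summable f ->
  (onb_sum (fun e => (a * f e)%R) <= (a * onb_fsum f)%:E)%E.
Proof.
move=> a0 sf; apply: ge_ereal_sup => _ [X [finX XE] <-].
rewrite fsbig_finite// sumEFin -mulr_sumr lee_fin ler_wpM2l// -lee_fin -onb_sumE//.
rewrite -sumEFin -fsbig_finite//; apply: esum_ge; exists X => //.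
Qed.

Lemma onb_summableZ f a : 0 <= a -> onb_summable f ->
  onb_summable (fun e => a * f e).
Proof.
move=> a0 sf; split=> [e|]; first by rewrite mulr_ge0// sf.1.
by apply: le_lt_trans (onb_sumZ_le a0 sf) _; rewrite ltry.
Qed.

Lemma onb_fsumZ f a : 0 <= a -> onb_summable f ->
  onb_fsum (fun e => a * f e) = a * onb_fsum f.
Proof.
move=> a0 sf; have saf := onb_summableZ a0 sf.
apply/eqP; rewrite eq_le; apply/andP; split.
  by rewrite -lee_fin -onb_sumE//; exact: onb_sumZ_le.
have [->|n0] := eqVneq a 0.
  by rewrite mul0r onb_fsum_ge0// => e; rewrite mul0r.
have ap : 0 < a by rewrite lt_neqAle eq_sym n0.
(* The reverse bound is [onb_sumZ_le] for the inverse scalar. *)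
rewrite -ler_pdivlMl// -lee_fin -onb_sumE//.
apply: le_trans (onb_sumZ_le _ saf); last by rewrite invr_ge0.
by apply: onb_sum_le => e; rewrite mulrA mulVf// mul1r.
Qed.

Lemma onb_fsum_eq0 f e : onb_summable f -> onb_fsum f = 0 -> onb e -> f e = 0.
Proof.
move=> sf f0 Ee; apply/eqP; rewrite eq_le sf.1 andbT -lee_fin -[leRHS]/(0%:E) -f0.
rewrite -onb_sumE//; apply: esum_ge; exists [set e].
  by split=> // _ ->.
by rewrite fsbig_set1.
Qed.

Definition hs_summand X : H -> R := fun e => '[X e, X e].

Definition hilbert_schmidt X := onb_summable (hs_summand X).

Definition hs_norm2 X := onb_fsum (hs_summand X).

Lemma hs_summand_ge0 X e : 0 <= hs_summand X e.
Proof. exact: inner_ge0. Qed.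

Lemma hs_norm2_ge0 X : 0 <= hs_norm2 X.
Proof. by apply: onb_fsum_ge0 => e; exact: inner_ge0. Qed.

(** By Parseval both sides are the double sum of squared matrix entries; exchanging the two indices
    exchanges [X] and its adjoint. *)
Lemma hs_sum_adj X : bounded_op X ->
  onb_sum (hs_summand (adj X)) = onb_sum (hs_summand X).
Proof.
move=> bX; rewrite /onb_sum.
have E Y : \esum_(e in onb) (hs_summand Y e)%:E =
    \esum_(e in onb) \esum_(f in onb) ('[Y e, f] ^+ 2)%:E.
  by apply: eq_esum => e _; rewrite parseval.
rewrite !E.
pose a (e f : H) : \bar R := ('[adj X e, f] ^+ 2)%:E.
have a0 e u : (0 <= a e u)%E by rewrite lee_fin sqr_ge0.
rewrite (esum_esum (a := a))//.
rewrite (esum_esum (a := fun e u => ('[X e, u] ^+ 2)%:E))//; last first.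
  by move=> e u _ _; rewrite lee_fin sqr_ge0.
rewrite (reindex_esum (onb `*`` fun=> onb) (onb `*`` fun=> onb) (fun p => (p.2, p.1))).
  by apply: eq_esum => -[e f] _ /=; rewrite /a adjP'// innerC.
split.
- by move=> [e f] [/= ? ?].
- by move=> [e f] [e' f'] _ _ [-> ->].
- by move=> [e f] [/= ? ?]; exists (f, e).
Qed.

Lemma hs_adj X : bounded_op X -> hilbert_schmidt X -> hilbert_schmidt (adj X).
Proof.
by move=> bX [h0 h]; split; [exact: hs_summand_ge0 | rewrite hs_sum_adj].
Qed.

Lemma hs_norm2_adj X : bounded_op X -> hs_norm2 (adj X) = hs_norm2 X.
Proof. by move=> bX; rewrite /hs_norm2 /onb_fsum hs_sum_adj. Qed.

Lemma hs_le X Y : (forall e, '[X e, X e] <= '[Y e, Y e]) ->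
  hilbert_schmidt Y -> hilbert_schmidt X.
Proof.
move=> XY; apply: onb_summable_le => e; rewrite hs_summand_ge0; exact: XY.
Qed.

(** A contraction applied last decreases each summand. One applied first is brought to that position
    by passing to adjoints. *)
Lemma hs_comp_contract X W : bounded_op X -> bounded_op W ->
  (forall u, '[adj W u, adj W u] <= '[u, u]) ->
  hilbert_schmidt X -> hilbert_schmidt (X \o W).
Proof.
move=> bX bW hW hX; have bXW := bop_comp bX bW.
rewrite -(adjK bXW); apply: hs_adj; first exact: bop_adj.
rewrite adj_compE//; apply: (hs_le (Y := adj X)); last exact: hs_adj.
by move=> e; exact: hW.
Qed.

Lemma hs_add X Y : hilbert_schmidt X -> hilbert_schmidt Y ->
  hilbert_schmidt (X + Y).
Proof.
move=> hX hY; apply: (onb_summable_le (g := fun e => (hs_summand X e + hs_summand Y e) +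
  (hs_summand X e + hs_summand Y e))).
  move=> e; rewrite hs_summand_ge0 /hs_summand addrfctE.
  have := inner_ge0 (X e - Y e); rewrite !innerE (innerC (Y e)); lra.
by do 2 apply: onb_summableD => //; exact: onb_summableD.
Qed.

Lemma hs_scale a X : hilbert_schmidt X -> hilbert_schmidt (a *: X).
Proof.
move=> hX; have := onb_summableZ (sqr_ge0 a) hX; congr onb_summable.
by apply/funext => e; rewrite /hs_summand scalrfctE !innerE; ring.
Qed.

Lemma hs_norm2_scale a X : hilbert_schmidt X ->
  hs_norm2 (a *: X) = a ^+ 2 * hs_norm2 X.
Proof.
move=> hX; rewrite /hs_norm2 -onb_fsumZ ?sqr_ge0//; congr onb_fsum.
by apply/funext => e; rewrite /hs_summand scalrfctE !innerE; ring.
Qed.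

Lemma hs_sub X Y : hilbert_schmidt X -> hilbert_schmidt Y ->
  hilbert_schmidt (X - Y).
Proof.
by move=> hX hY; apply: hs_add => //; rewrite -scaleN1r; exact: hs_scale.
Qed.

Lemma hs_norm2_eq0 X : bounded_op X -> hilbert_schmidt X -> hs_norm2 X = 0 ->
  X = 0.
Proof.
move=> bX hX X0; have h e : onb e -> X e = 0.
  by move=> Ee; apply: inner_eq0; exact: (onb_fsum_eq0 hX X0 Ee).
(* Once [X] kills the basis, every value of [adj X] is orthogonal to the basis, so its completeness
   applies directly. *)
suff h0 : adj X = 0.
  apply/funext => x; apply: inner_ext => z.
  by rewrite adjP// h0 inner0r inner0l.
apply/funext => x.
have : orth onb (adj X x) by move=> e Ee; rewrite adjP'// h// inner0r.
by rewrite onbP.2.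
Qed.

Lemma trace_ge0E T : (forall x, 0 <= '[T x, x]) ->
  trace T = onb_fsum (fun e => '[T e, e]).
Proof.
move=> T0; rewrite /trace /onb_fsum /onb_sum; congr fine.
rewrite [X in (_ - X)%E]esum1 => [|e Ee]; last first.
  by rewrite (@ge0_funenegE _ _ setT) ?inE// => x _; rewrite lee_fin.
rewrite sube0; apply: eq_esum => e Ee.
by rewrite (@ge0_funeposE _ _ setT) ?inE// => x _; rewrite lee_fin.
Qed.

Lemma B1plusP T : B1plus T <-> psd_op T /\ onb_summable (fun e => '[T e, e]).
Proof.
split=> [[pT [_ hT]]|[pT [T0 hT]]]; split=> //.
- by split=> [e|]; [exact: psd_ge0 | move: hT; rewrite abs_op_psd].
- by split; [exact: psd_bop | rewrite abs_op_psd].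
Qed.

Lemma B1plus_comp_adj X : bounded_op X -> hilbert_schmidt X ->
  B1plus (X \o adj X).
Proof.
move=> bX hX; apply/B1plusP; split; first exact: psd_comp_adj.
have := hs_adj bX hX; congr onb_summable.
by apply/funext => e; rewrite /hs_summand /= (adjP bX).
Qed.

Lemma trace_comp_adj X : bounded_op X -> trace (X \o adj X) = hs_norm2 X.
Proof.
move=> bX; rewrite -hs_norm2_adj// trace_ge0E.
  by congr onb_fsum; apply/funext => e; rewrite /hs_summand /= (adjP bX).
by move=> x /=; rewrite (adjP bX) inner_ge0.
Qed.

Lemma hs_of_B1plus X : bounded_op X -> B1plus (X \o adj X) -> hilbert_schmidt X.
Proof.
move=> bX /B1plusP[_ h]; rewrite -(adjK bX); apply: hs_adj; first exact: bop_adj.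
move: h; congr onb_summable; apply/funext => e.
by rewrite /hs_summand /= (adjP bX).
Qed.

End HilbertSchmidt.

(** * Couplings *)

Section Coupling.
Context {R : realType} {H : hilbertType R}.
Implicit Types (x y z u v w : H) (S T X Y : H -> H).

Lemma sqrt_comp_adj_inner X u v : bounded_op X ->
  '[sqrt_op (X \o adj X) u, sqrt_op (X \o adj X) v] = '[adj X u, adj X v].
Proof.
by move=> bX; rewrite sqrt_inner; [rewrite /= (adjP bX) | exact: psd_comp_adj].
Qed.

Lemma psd_conj_sqrt S T : psd_op S -> psd_op T ->
  psd_op (sqrt_op S \o T \o sqrt_op S).
Proof.
move=> pS pT; have pS2 := psd_sqrt pS.
by have := psd_conj pT (psd_bop pS2); rewrite psd_adj.
Qed.

(** [S] and its root have the same null space, so the hypothesis puts the range of the root in the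
    double orthogonal of [D]. This is how the range of [Q] is placed in the initial spaces of [U]
    and [V]. *)
Lemma range_sqrt_closure S (D : set H) e : psd_op S -> lin_sub D ->
  (forall z, orth D z -> S z = 0) -> closure D (sqrt_op S e).
Proof.
move=> pS sD h; apply: orth_orth => // z /h Sz.
rewrite (psd_sym _ _ (psd_sqrt pS)).
suff -> : sqrt_op S z = 0 by rewrite inner0r.
by apply: inner_eq0; rewrite sqrt_inner// Sz inner0l.
Qed.

Section Defect.
Variables G F : H -> H.
Hypotheses (bG : bounded_op G) (bF : bounded_op F).
Hypotheses (hG : hilbert_schmidt G) (hF : hilbert_schmidt F).

Let S := G \o adj G.
Let T := F \o adj F.
Let S2 := sqrt_op S.
Let P := sqrt_op (S2 \o T \o S2).
Let Q := sqrt_op P.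

(* With polar decompositions adj G = V S2 and adj F S2 = U P, the inner product
   of G and F is that of Q (adj U) and Q (adj V), while these both have the
   Hilbert-Schmidt norm of Q. *)
Lemma coupling_defect :
  exists D : H -> H, [/\ bounded_op D, hilbert_schmidt D,
    hs_norm2 (G - F) = W2sq S T + hs_norm2 D & D = 0 <-> psd_op (adj G \o F)].
Proof.
have bG' := bop_adj bG; have bF' := bop_adj bF.
have pS : psd_op S by exact: psd_comp_adj.
have pT : psd_op T by exact: psd_comp_adj.
have pS2 : psd_op S2 by exact: psd_sqrt.
have bS2 := psd_bop pS2.
have pSTS : psd_op (S2 \o T \o S2) by exact: psd_conj_sqrt.
have pP : psd_op P by exact: psd_sqrt.
have bP := psd_bop pP.
have pQ : psd_op Q by exact: psd_sqrt.
have bQ := psd_bop pQ.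
have bFS : bounded_op (adj F \o S2) by exact: bop_comp.
have [V pV] : exists V, partial_isometry (adj G) S2 V.
  by apply: partial_isometry_exists => // u; rewrite sqrt_comp_adj_inner.
have [U pU] : exists U, partial_isometry (adj F \o S2) P U.
  apply: partial_isometry_exists => // u.
  by rewrite sqrt_inner//= (psd_sym _ _ pS2) -(adjP bF).
have bU := pi_bop pU; have bV := pi_bop pV.
have bU' := bop_adj bU; have bV' := bop_adj bV.
have GE x : G x = S2 (adj V x).
  apply: inner_ext => z.
  by rewrite (adjP bG) -(pi_fwd pV) -(adjP' bV) (psd_sym _ _ pS2).
have SFE x : S2 (F x) = P (adj U x).
  apply: inner_ext => z.
  rewrite (psd_sym _ _ pS2) (adjP bF) (psd_sym _ _ pP) (adjP' bU) (pi_fwd pU) //.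
have GFE x : adj G (F x) = V (P (adj U x)) by rewrite -(pi_fwd pV) SFE.
have P_null z : S2 z = 0 -> P z = 0.
  move=> Sz; apply: inner_eq0; rewrite sqrt_inner//= Sz.
  by rewrite (bop0 (psd_bop pT)) (bop0 bS2) inner0l.
have PVV x : adj V (V (Q x)) = Q x.
  apply: (pi_compl pV); apply: range_sqrt_closure => //; first exact: lin_sub_range.
  by move=> z; rewrite -null_psd_orth//; exact: P_null.
have PUU x : adj U (U (Q x)) = Q x.
  apply: (pi_compl pU); apply: range_sqrt_closure => //; first exact: lin_sub_range.
  by move=> z; rewrite -null_psd_orth.
have QQ x : Q (Q x) = P x by exact: sqrtK.
have hS2 : hilbert_schmidt S2.
  by apply: hs_le (hs_adj bG hG) => e; rewrite sqrt_comp_adj_inner.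
have hFU : hilbert_schmidt (F \o U).
  by apply: hs_comp_contract => //; exact: pi_adj_le pU.
(* Here |Q e|^2 is the form of [P], which equals the inner product of [S2 e] and [F (U e)] and is at
   most the sum of their squared norms. *)
have hQ : hilbert_schmidt Q.
  apply: (onb_summable_le (g := fun e => hs_summand S2 e + hs_summand (F \o U) e)).
    move=> e; rewrite hs_summand_ge0 /hs_summand sqrt_inner//.
    rewrite -(pi_bwd pU) (adjP' bU) /= (adjP' bF).
    have := inner_ge0 (S2 e - F (U e)); rewrite !innerE (innerC (F (U e)) (S2 e)).
    by have := inner_ge0 (S2 e); have := inner_ge0 (F (U e)); lra.
  exact: onb_summableD.
have contr (W : H -> H) : bounded_op W -> (forall u, '[W u, W u] <= '[u, u]) ->
    (forall x, adj W (W (Q x)) = Q x) ->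
    hilbert_schmidt (Q \o adj W) /\ hs_norm2 (Q \o adj W) = hs_norm2 Q.
  move=> bW W1 WW; have bW' := bop_adj bW; have bWQ := bop_comp bW bQ.
  split; first by apply: hs_comp_contract => //; rewrite adjK.
  rewrite -(psd_adj pQ) -adj_compE// hs_norm2_adj// psd_adj//.
  congr onb_fsum; apply/funext => e; rewrite /hs_summand /=.
  by rewrite (adjP bW) WW.
have [hQU nQU] := contr U bU (pi_le pU) PUU.
have [hQV nQV] := contr V bV (pi_le pV) PVV.
pose D := (Q \o adj U) - (Q \o adj V).
have bD : bounded_op D := bop_sub (bop_comp bQ (bop_adj bU)) (bop_comp bQ (bop_adj bV)).
have hD : hilbert_schmidt D by exact: hs_sub.
exists D; split=> //.
- have trP : trace P = hs_norm2 Q.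
    rewrite trace_ge0E; last by move=> x; exact: psd_ge0.
    by congr onb_fsum; apply/funext => e; rewrite /hs_summand sqrt_inner.
  have hGF : hilbert_schmidt (G - F) by exact: hs_sub.
  rewrite /W2sq -/S2 -/P trP !trace_comp_adj//.
  (* Subtraction-free form of the claim, valid for each basis vector because [G e], [F e] have the
     same inner product as [Q (adj U e)], [Q (adj V e)]. *)
  suff : hs_norm2 (G - F) + (hs_norm2 (Q \o adj U) + hs_norm2 (Q \o adj V)) =
      (hs_norm2 G + hs_norm2 F) + hs_norm2 D by rewrite nQU nQV; lra.
  rewrite -!onb_fsumD//; last 2 first.
  + exact: onb_summableD.
  + exact: onb_summableD.
  congr onb_fsum; apply/funext => e; rewrite /hs_summand.
  rewrite [D e]/(Q (adj U e) - Q (adj V e)) [(G - F) e]/(G e - F e) /=.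
  have : '[G e, F e] = '[Q (adj U e), Q (adj V e)].
    by rewrite GE (psd_sym _ _ pS2) SFE innerC sqrt_inner.
  by rewrite !innerE (innerC (F e) (G e)) (innerC (Q (adj V e))); lra.
split.
- move=> D0; have QE x : Q (adj U x) = Q (adj V x).
    by apply/eqP; rewrite -subr_eq0; have -> : Q (adj U x) - Q (adj V x) = D x by []; rewrite D0.
  have bVQ := bop_comp bV bQ.
  suff -> : adj G \o F = (V \o Q) \o adj (V \o Q) by exact: psd_comp_adj.
  apply/funext => x /=; rewrite (adj_compE bV bQ) (psd_adj pQ) /=.
  by rewrite GFE -QQ QE.
- move=> pZ; have bVQ := bop_comp bV bQ.
  have PE x : adj V (V (P x)) = P x by rewrite -QQ PVV.
  have PE' x : adj U (U (P x)) = P x by rewrite -QQ PUU.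
  have VQadj : adj (V \o Q) = Q \o adj V by rewrite (adj_compE bV bQ) (psd_adj pQ).
  (* Write Z = G^* F = V P U^*. As Z is self-adjoint, Z^2 = Z Z^* = V P^2 V^*, which is also the
     square of V P V^*; uniqueness of positive roots identifies the two. Applying V^* then shows
     that P U^* = P V^*. *)
  have ZV : adj G \o F = (V \o Q) \o adj (V \o Q).
    apply: psd_sqr_inj => //; first exact: psd_comp_adj.
    have Zadj : adj F \o G = adj G \o F.
      by rewrite -[RHS](psd_adj pZ) (adj_compE bG' bF) (adjK bG).
    have FGE x : adj G (F x) = U (P (adj V x)).
      rewrite (pi_fwd pU) /= -GE.
      exact: (congr1 (fun f : H -> H => f x) (esym Zadj)).
    by apply/funext => x /=; rewrite VQadj /= PVV !QQ [adj G (F x)]FGE GFE PE'.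
  apply/funext => x; have -> : D x = Q (adj U x - adj V x) by rewrite (bopB _ _ bQ).
  have : null P (adj U x - adj V x).
    rewrite /null /= (bopB _ _ bP) -[P (adj U x)]PE -GFE.
    have -> : adj G (F x) = (adj G \o F) x by [].
    by rewrite ZV /= VQadj /= PVV QQ subrr.
  by rewrite -null_sqrt.
Qed.

Lemma W2sq_le_coupling : W2sq S T <= hs_norm2 (G - F).
Proof.
by have [D [_ _ -> _]] := coupling_defect; rewrite lerDl hs_norm2_ge0.
Qed.

Lemma W2sq_psd_coupling : psd_op (adj G \o F) -> W2sq S T = hs_norm2 (G - F).
Proof.
have [D [bD hD -> DP]] := coupling_defect; move/DP => D0.
suff -> : hs_norm2 D = 0 by rewrite addr0.
rewrite D0; have := hs_norm2_scale 0 hG.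
by rewrite scale0r expr0n mul0r.
Qed.

Lemma psd_of_optimal_coupling : hs_norm2 (G - F) <= W2sq S T ->
  psd_op (adj G \o F).
Proof.
have [D [bD hD -> DP]] := coupling_defect; rewrite gerDl => h.
by apply/DP/hs_norm2_eq0 => //; apply/eqP; rewrite eq_le h hs_norm2_ge0.
Qed.

End Defect.
End Coupling.

(** * Block operators *)

Section Blocks.
Context {R : realType} {H : hilbertType R}.
Implicit Types (x y z u v w : H) (S T X Y L Z : H -> H).
Local Notation proj := Defs.proj.
Local Notation pinv := Defs.pinv.

(** Each [Z y] is in the range of [T], so the default value of [pinv] is never taken, and
    orthogonality to [null T] singles out [L] among all solutions. Every pseudoinverse in [schur]
    and [Mop] is evaluated in this way. *)
Lemma pinv_comp T L Z : bounded_op T -> (forall x, T (L x) = Z x) ->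
  (forall x, orth (null T) (L x)) -> pinv T \o Z = L.
Proof.
move=> bT TL oL; apply/funext => y /=; rewrite /pinv.
case: xgetP => [x _ [ox oTx]|h]; last first.
  by case: (h (L y)); split=> // w _; rewrite TL subrr inner0l.
have T0 : T (x - L y) = 0.
  apply: (@orth_self _ _ (range T)); first by exists (x - L y).
  rewrite (bopB _ _ bT) TL; rewrite -opprB => w /oTx h.
  by rewrite innerNl h oppr0.
apply/eqP; rewrite -subr_eq0; apply/eqP/(@orth_self _ _ (null T)) => //.
exact: (lin_subB (lin_sub_orth (null T))).
Qed.

Lemma closure_range_orth_null T x : psd_op T -> closure (range T) x ->
  orth (null T) x.
Proof.
move=> pT cx z; rewrite null_psd_orth// => oz.
by apply: closure_inner0 cx _ => d Dd; rewrite innerC oz.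
Qed.

Section Projections.
Variable A : H -> H.
Hypothesis pA : psd_op A.
Local Notation P1 := (proj (Hone A)).
Local Notation P2 := (proj (Htwo A)).
Local Notation A2 := (sqrt_op A).

Lemma csub_Hone : csub (Hone A).
Proof. exact/csub_closure/lin_sub_range/psd_bop. Qed.

Lemma csub_Htwo : csub (Htwo A).
Proof. exact/csub_null/psd_bop. Qed.

Lemma Htwo_orth : Htwo A = orth (Hone A).
Proof. by rewrite /Htwo /Hone orth_closure null_psd_orth. Qed.

Lemma proj_Htwo x : P2 x = x - P1 x.
Proof.
have c1 := csub_Hone; apply: (proj_uniq csub_Htwo).
  by rewrite Htwo_orth; exact: proj_orth.
rewrite subKr => z; rewrite Htwo_orth innerC; apply; exact: proj_in.
Qed.

Lemma proj_split x : x = P1 x + P2 x.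
Proof. by rewrite proj_Htwo addrC subrK. Qed.

Lemma bop_proj1 : bounded_op P1. Proof. exact: bop_proj csub_Hone. Qed.
Lemma bop_proj2 : bounded_op P2. Proof. exact: bop_proj csub_Htwo. Qed.

Lemma proj1_sym x y : '[P1 x, y] = '[x, P1 y].
Proof. exact: proj_sym csub_Hone. Qed.
Lemma proj2_sym x y : '[P2 x, y] = '[x, P2 y].
Proof. exact: proj_sym csub_Htwo. Qed.

Lemma proj11 x : P1 (P1 x) = P1 x.
Proof. by rewrite (proj_id csub_Hone)//; exact: proj_in csub_Hone. Qed.
Lemma proj22 x : P2 (P2 x) = P2 x.
Proof. by rewrite (proj_id csub_Htwo)//; exact: proj_in csub_Htwo. Qed.
Lemma proj12 x : P1 (P2 x) = 0.
Proof. by rewrite proj_Htwo (bopB _ _ bop_proj1) proj11 subrr. Qed.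
Lemma proj21 x : P2 (P1 x) = 0.
Proof. by rewrite proj_Htwo proj11 subrr. Qed.

Lemma null_sqrt_Htwo x : A2 x = 0 <-> P2 x = x.
Proof.
have -> : (A2 x = 0) = Htwo A x by rewrite /Htwo -null_sqrt.
split=> [|<-]; first exact: (proj_id csub_Htwo).
exact: proj_in csub_Htwo.
Qed.

Lemma sqrt_proj2 x : A2 (P2 x) = 0.
Proof. by apply/null_sqrt_Htwo; rewrite proj22. Qed.

Lemma sqrt_proj1 x : A2 (P1 x) = A2 x.
Proof.
have bA2 := psd_bop (psd_sqrt pA).
by rewrite [in RHS](proj_split x) (bopD _ _ bA2) sqrt_proj2 addr0.
Qed.

Lemma proj2_sqrt x : P2 (A2 x) = 0.
Proof.
apply: inner_ext => z.
by rewrite proj2_sym (psd_sym _ _ (psd_sqrt pA)) sqrt_proj2 inner0r inner0l.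
Qed.

Lemma proj1_sqrt x : P1 (A2 x) = A2 x.
Proof. by rewrite [RHS](proj_split (A2 x)) proj2_sqrt addr0. Qed.

Lemma block11_self : block11 A A = A.
Proof.
apply/funext => x; rewrite /block11 /block /= -(sqrtK _ pA) sqrt_proj1 sqrtK//.
by rewrite -[in RHS]sqrtK// -proj1_sqrt sqrtK.
Qed.

Lemma inner_proj12 x y : P1 x = x -> P2 y = y -> '[x, y] = 0.
Proof. by move=> <- <-; rewrite proj1_sym proj12 inner0r. Qed.

Variable B : H -> H.
Hypothesis pB : psd_op B.
Local Notation B11 := (block11 A B).
Local Notation Bh := (sqrt_op (block11 A B)).
Local Notation C := (core A B).

Lemma psd_block11 : psd_op B11.
Proof.
have := psd_conj pB bop_proj1.
by rewrite (adj_proj csub_Hone).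
Qed.

Lemma coreE : C = sqrt_op (A2 \o B11 \o A2).
Proof. by rewrite /core block11_self. Qed.

Lemma psd_core : psd_op C.
Proof. by rewrite coreE; apply/psd_sqrt/psd_conj_sqrt => //; exact: psd_block11. Qed.

Lemma core_inner x y : '[C x, C y] = '[B (A2 x), A2 y].
Proof.
rewrite coreE sqrt_inner; last exact/psd_conj_sqrt/psd_block11.
rewrite /= (psd_sym _ _ (psd_sqrt pA)) /block11 /block /=.
by rewrite proj1_sym !proj1_sqrt.
Qed.

Lemma sqrt_block11_proj2 x : Bh (P2 x) = 0.
Proof.
apply: inner_eq0; rewrite sqrt_inner; last exact: psd_block11.
by rewrite /block11 /block /= proj12 (bop0 (psd_bop pB)) (bop0 bop_proj1) inner0l.
Qed.

Lemma sqrt_block11_proj1 x : Bh (P1 x) = Bh x.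
Proof.
have bBh := psd_bop (psd_sqrt psd_block11).
by rewrite [in RHS](proj_split x) (bopD _ _ bBh) sqrt_block11_proj2 addr0.
Qed.

Lemma proj1_sqrt_block11 x : P1 (Bh x) = Bh x.
Proof.
apply: inner_ext => z; have pBh := psd_sqrt psd_block11.
by rewrite proj1_sym !(psd_sym _ _ pBh) sqrt_block11_proj1.
Qed.

(** Translates the range condition of [admissible] into [C \o N = 0]. *)
Lemma null_core z : C z = 0 <-> Bh (A2 z) = 0.
Proof.
have E : '[C z, C z] = '[Bh (A2 z), Bh (A2 z)].
  rewrite core_inner sqrt_inner; last exact: psd_block11.
  by rewrite /block11 /block /= proj1_sym !proj1_sqrt.
by split=> h; apply: inner_eq0; [rewrite -E|rewrite E]; rewrite h inner0l.
Qed.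

(* K is B11^(†/2) B12, and M and L are the entries M11 and M21^* of Mop for
   N12 = 0: the equations below avoid all unbounded pseudoinverses. *)
Record block_factors (K L M : H -> H) : Prop := BlockFactors {
  bf_bK : bounded_op K;
  bf_bL : bounded_op L;
  bf_bM : bounded_op M;
  bf_schur : schur B A = block22 A B - (adj K \o K);
  bf_pinvM : pinv A2 \o C = M;
  bf_pinvL : pinv C \o A2 \o block12 A B = L;
  bf_KL : forall x, '[L x, L x] = '[K x, K x];
  bf_Kle : forall x, '[K x, K x] <= '[B (P2 x), P2 x];
  bf_sqrtM : forall x, A2 (M x) = C x;
  bf_coreL : forall x, C (L x) = A2 (B (P2 x));
  bf_Lproj2 : forall x, L (P2 x) = L x;
  bf_proj1L : forall x, P1 (L x) = L x;
  bf_Lorth : forall x z, C z = 0 -> '[L x, z] = 0;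
  bf_Mnull : forall z, C z = 0 -> M z = 0;
  bf_adjM_norm : forall x, '[adj M x, adj M x] = '[B (P1 x), P1 x];
  bf_adjM_L : forall x, '[adj M x, L x] = '[P1 x, B (P2 x)]
}.

(** Two polar decompositions, of [sqrt_op B \o P1] relative to [Bh] and of [Bh \o A2] relative to
    [C], supply bounded solutions of all the equations: K = V^* B^(1/2) P2, L = W^* K and M = Bh
    W. *)
Lemma block_factors_exist : exists K L M, block_factors K L M.
Proof.
have pA2 := psd_sqrt pA; have bA2 := psd_bop pA2.
have pB2 := psd_sqrt pB; have bB2 := psd_bop pB2.
have pBh := psd_sqrt psd_block11; have bBh := psd_bop pBh.
have pC := psd_core; have bC := psd_bop pC.
have [b1 b2] := (bop_proj1, bop_proj2).
have [V pV] : exists V, partial_isometry (sqrt_op B \o P1) Bh V.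
  apply: partial_isometry_exists => //; first exact: bop_comp.
  move=> u; rewrite /= sqrt_inner// sqrt_inner; last exact: psd_block11.
  by rewrite /block11 /block /= proj1_sym.
have [W pW] : exists W, partial_isometry (Bh \o A2) C W.
  apply: partial_isometry_exists => //; first exact: bop_comp.
  move=> u; rewrite /= core_inner sqrt_inner; last exact: psd_block11.
  by rewrite /block11 /block /= proj1_sym !proj1_sqrt.
have bV := pi_bop pV; have bW := pi_bop pW.
have bV' := bop_adj bV; have bW' := bop_adj bW.
pose K := adj V \o (sqrt_op B \o P2).
have bK : bounded_op K by apply: bop_comp => //; exact: bop_comp.
have BhV x : Bh (adj V x) = P1 (sqrt_op B x).
  apply: inner_ext => z; rewrite (psd_sym _ _ pBh) (adjP' bV) (pi_fwd pV) /=.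
  by rewrite proj1_sym (psd_sym _ _ pB2).
have BhK x : Bh (K x) = block12 A B x by rewrite /K /= BhV sqrtK.
have Kcl x : closure (range Bh) (K x) by exact: (pi_adj_range pV).
have CE x : C x = A2 (Bh (W x)).
  apply: inner_ext => z; rewrite (psd_sym _ _ pC) (psd_sym _ _ pA2).
  by rewrite (psd_sym _ _ pBh) (adjP bW) (pi_bwd pW).
have CW x : C (adj W x) = A2 (Bh x).
  apply: inner_ext => z; rewrite (psd_sym _ _ pC) (adjP' bW) (pi_fwd pW) /=.
  by rewrite (psd_sym _ _ pA2) (psd_sym _ _ pBh).
(* [W] is built from [Bh \o A2], but its final space already contains the range of [Bh]: [A2] is
   injective on [Hone A], where all values of [Bh] lie. *)
have BhWW x : Bh (W (adj W x)) = Bh x.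
  have : A2 (Bh (W (adj W x)) - Bh x) = 0 by rewrite (bopB _ _ bA2) -CE CW subrr.
  move/null_sqrt_Htwo; rewrite proj_Htwo (bopB _ _ b1) !proj1_sqrt_block11 subrr.
  by move/esym/eqP; rewrite subr_eq0 => /eqP.
have WWBh x : W (adj W (Bh x)) = Bh x.
  apply: inner_ext => z; rewrite (adjP bW) (adjP' bW) (psd_sym _ _ pBh) BhWW.
  by rewrite (psd_sym _ _ pBh).
have WWK x : W (adj W (K x)) = K x.
  apply/eqP; rewrite -subr_eq0; apply/eqP.
  have bD := bop_sub (bop_comp bW bW') (bop_id (H := H)).
  apply: (comp_eq0_orth bD _ (Kcl x)) => u.
  by rewrite [LHS](_ : _ = W (adj W (Bh u)) - Bh u)// WWBh subrr.
pose L := adj W \o K; pose M := Bh \o W.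
have bL : bounded_op L by exact: bop_comp.
have bM : bounded_op M by exact: bop_comp.
have CL x : C (L x) = A2 (block12 A B x) by rewrite /L /= CW BhK.
have LC x : closure (range C) (L x) by exact: (pi_adj_range pW).
have Wnull z : C z = 0 -> W z = 0.
  by move=> Cz; apply: (pi_eq0 pW); rewrite -null_psd_orth.
have adjM x : adj M x = adj W (Bh x) by rewrite /M (adj_compE bBh bW) (psd_adj pBh).
exists K, L, M; split=> //.
- rewrite /schur; suff -> : pinv Bh \o block12 A B = K by [].
  by apply: pinv_comp => // x; apply: closure_range_orth_null.
- apply: (pinv_comp bA2) => [x|x]; first by rewrite /M /= -CE.
  rewrite null_sqrt// => z; rewrite -[null A]/(Htwo A) => hz.
  apply: inner_proj12; first exact: proj1_sqrt_block11.
  exact: (proj_id csub_Htwo).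
- have -> : pinv C \o A2 \o block12 A B = pinv C \o (A2 \o block12 A B) by [].
  by apply: pinv_comp => // x; apply: closure_range_orth_null.
- by move=> x; rewrite /L /= (adjP' bW) WWK.
- move=> x; apply: le_trans (pi_adj_le pV _) _.
  by rewrite /= sqrt_inner.
- by move=> x; rewrite CL /block12 /block /= sqrt_proj1.
- by move=> x; rewrite /L /K /= proj22.
- move=> x; have : orth (Htwo A) (L x).
    move=> z hz; apply: (closure_range_orth_null pC (LC x)).
    rewrite /null /= null_core -(proj_id csub_Htwo hz) sqrt_proj2; exact: bop0.
  move=> oL; rewrite [RHS](proj_split (L x)) (proj_eq0 csub_Htwo oL) addr0//.
- by move=> x z Cz; apply: (closure_range_orth_null pC (LC x)).
- by move=> z Cz; rewrite /M /= Wnull// (bop0 bBh).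
- move=> x; rewrite adjM (adjP' bW) WWBh sqrt_inner; last exact: psd_block11.
  by rewrite /block11 /block /= proj1_sym.
- move=> x; rewrite adjM (adjP' bW) /L /= WWK (psd_sym _ _ pBh) BhK.
  by rewrite /block12 /block /= proj1_sym.
Qed.

End Projections.
End Blocks.

(** * Completing the prescribed blocks to a factor of [B] *)

Section OptimalOperators.
Context {R : realType} {H : hilbertType R}.
Implicit Types (x y z u v w : H) (S T X Y L Z N : H -> H).
Local Notation proj := Defs.proj.
Local Notation pinv := Defs.pinv.

Section Pair.
Variables A B : H -> H.
Hypotheses (pA : psd_op A) (pB : psd_op B).
Local Notation P1 := (proj (Hone A)).
Local Notation P2 := (proj (Htwo A)).
Local Notation A2 := (sqrt_op A).
Local Notation C := (core A B).

Section Factors.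
Variables K L M : H -> H.
Hypothesis bf : block_factors A B K L M.

Lemma schur_inner x y :
  '[schur B A x, y] = '[B (P2 x), P2 y] - '[K x, K y].
Proof.
rewrite (bf_schur bf) [LHS](_ : _ = '[block22 A B x - adj K (K x), y])//.
rewrite innerBl (adjP' (bf_bK bf)) /block22 /block /=.
by rewrite (proj2_sym pA).
Qed.

Lemma psd_schur : psd_op (schur B A).
Proof.
have bK := bf_bK bf; have bK' := bop_adj bK; split.
- rewrite (bf_schur bf); apply: bop_sub; last exact: bop_comp.
  have b2 := bop_proj2 pA; have bB := psd_bop pB.
  by apply: bop_comp => //; apply: bop_comp.
- move=> x y; rewrite [RHS]innerC !schur_inner (innerC (K y)).
  by rewrite (psd_sym _ _ pB) innerC.
- by move=> x; rewrite schur_inner subr_ge0; exact: bf_Kle bf x.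
Qed.

Section Completion.
Variables N M2 : H -> H.
Hypotheses (bN : bounded_op N) (bM2 : bounded_op M2).
Hypotheses (N1 : forall x, P1 (N x) = N x) (N2 : forall x, N (P2 x) = N x).
Hypothesis CN : forall x, C (N x) = 0.
Hypotheses (M21 : forall x, P2 (M2 x) = M2 x) (M22E : forall x, M2 (P2 x) = M2 x).
Hypothesis M2N : forall x,
  '[adj M2 x, adj M2 x] = '[schur B A x, x] - '[N x, N x].

Let bLN : bounded_op (L + N) := bop_add (bf_bL bf) bN.
Let bLN' := bop_adj bLN.

Lemma bop_completion : bounded_op (M + adj (L + N) + M2).
Proof. exact: bop_add (bop_add (bf_bM bf) bLN') bM2. Qed.

(** Both lower blocks take values in [Htwo A], which [A2] annihilates. What remains is positive
    semidefinite, so the completed factor is optimal whatever [N] is. *)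
Lemma sqrt_completion x : A2 ((M + adj (L + N) + M2) x) = C x.
Proof.
have bA2 := psd_bop (psd_sqrt pA).
rewrite [_ x](_ : _ = M x + adj (L + N) x + M2 x)// !(bopD _ _ bA2).
rewrite (bf_sqrtM bf) -M21 (sqrt_proj2 pA) addr0.
suff -> : A2 (adj (L + N) x) = 0 by rewrite addr0.
apply: inner_ext => z; rewrite (psd_sym _ _ (psd_sqrt pA)) (adjP' bLN) inner0l.
rewrite [(L + N) _](_ : _ = L (A2 z) + N (A2 z))//.
rewrite -(bf_Lproj2 bf) -N2 (proj2_sqrt pA) (bop0 (bf_bL bf)) (bop0 bN).
by rewrite addr0 inner0r.
Qed.

(** The vectors [a], [l], [n] lie in [Hone A] and [m] in [Htwo A], while [C N = 0] makes [n]
    orthogonal to [a] and [l]. Hence [N] contributes only the square of [n], which [M2N] subtracts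
    again. *)
Lemma completion_comp_adj :
  (M + adj (L + N) + M2) \o adj (M + adj (L + N) + M2) = B.
Proof.
have bM := bf_bM bf; have bX := bop_completion.
apply: quad_ext.
- exact: psd_bop (psd_comp_adj bX).
- exact: psd_bop.
- by have [] := psd_comp_adj bX.
- by case: pB.
move=> x; rewrite /= (adjP bX) (adj_addE (bop_add bM bLN') bM2) (adj_addE bM bLN').
rewrite (adjK bLN).
set a := adj M x; set l := L x; set n := N x; set m := adj M2 x.
rewrite [_ x](_ : _ = a + (l + n) + m)//.
have mP : P2 m = m.
  apply: inner_ext => z.
  by rewrite (proj2_sym pA) !(adjP' bM2) M22E.
have aP : P1 a = a.
  rewrite [RHS](proj_split pA a) [X in _ = _ + X](_ : _ = 0) ?addr0//.
  apply: inner_ext => z; rewrite (proj2_sym pA) (adjP' bM) inner0l (bf_Mnull bf) ?inner0r//.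
  apply/(null_core pA pB); rewrite (sqrt_proj2 pA).
  exact/bop0/psd_bop/psd_sqrt/psd_block11.
have am := inner_proj12 pA aP mP.
have lm := inner_proj12 pA (bf_proj1L bf x) mP.
have nm := inner_proj12 pA (N1 x) mP.
have an : '[a, n] = 0 by rewrite /a (adjP' bM) (bf_Mnull bf (CN x)) inner0r.
have ln : '[l, n] = 0 by exact: (bf_Lorth bf _ (CN x)).
have bB := psd_bop pB.
rewrite [in RHS](proj_split pA x) (bopD _ _ bB) !innerE.
have := M2N x; rewrite schur_inner -(bf_KL bf) -/m -/n -/l.
have := bf_adjM_norm bf x; rewrite -/a.
have := bf_adjM_L bf x; rewrite -/a -/l.
rewrite !(innerC m) (innerC l a) (innerC n a) (innerC n l) am lm nm an ln.
rewrite (innerC (B (P2 x)) (P1 x)) (psd_sym (P1 x) (P2 x) pB); lra.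
Qed.

End Completion.
End Factors.
End Pair.
End OptimalOperators.

(** * Admissible operators and optimal couplings *)

Section AdmissibleOperators.
Context {R : realType} {H : hilbertType R}.
Implicit Types (x y z u v w : H) (S T X Y L Z N : H -> H).
Local Notation proj := Defs.proj.
Local Notation pinv := Defs.pinv.

Section Pair.
Variables A B : H -> H.
Hypotheses (pA : psd_op A) (pB : psd_op B).
Local Notation P1 := (proj (Hone A)).
Local Notation P2 := (proj (Htwo A)).
Local Notation A2 := (sqrt_op A).
Local Notation C := (core A B).

Lemma bop_comp_adj_le X Y : bounded_op X -> X \o adj X = Y ->
  forall x, '[adj X x, adj X x] = '[Y x, x].
Proof. by move=> bX <- x /=; rewrite (adjP bX). Qed.

Lemma admissible_block N : admissible A B N ->
  [/\ bounded_op N, forall x, P1 (N x) = N x, forall x, N (P2 x) = N x &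
    forall x, C (N x) = 0].
Proof.
move=> [[bN EN] rN _].
have E x : N x = P1 (N (P2 x)) by rewrite {1}EN.
split=> // x.
- by rewrite E (proj11 pA).
- by rewrite E (proj22 pA) -E.
- apply/(null_core pA pB).
  by have := rN (N x) (ex_intro2 _ _ x I erefl); rewrite /null /= block11_self.
Qed.

(* The square root of D is one of the possible M22. *)
Lemma residual_sqrt N (D := schur B A - (adj N \o N)) : bounded_op N ->
  (forall x, N (P2 x) = N x) -> psd_op D ->
  [/\ op_between (Htwo A) (Htwo A) (sqrt_op D),
      sqrt_op D \o adj (sqrt_op D) = D,
      forall x, P2 (sqrt_op D x) = sqrt_op D x &
      forall x, sqrt_op D (P2 x) = sqrt_op D x].
Proof.
move=> bN N2 pD; have pD2 := psd_sqrt pD; have bD2 := psd_bop pD2.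
have [K [L [M bf]]] := block_factors_exist pA pB.
(* On [Hone A] the form of [D] is minus a sum of two squares, so its positivity forces it to vanish
   there. *)
have D1 x : sqrt_op D (P1 x) = 0.
  apply: inner_eq0; rewrite sqrt_inner//.
  have hle : '[D (P1 x), P1 x] <= 0.
    rewrite [D _](_ : _ = schur B A (P1 x) - adj N (N (P1 x)))//.
    rewrite innerBl (schur_inner pA bf) (proj21 pA) (bop0 (psd_bop pB)) inner0l.
    rewrite (adjP' bN) sub0r.
    by have := inner_ge0 (K (P1 x)); have := inner_ge0 (N (P1 x)); lra.
  by apply/eqP; rewrite eq_le hle psd_ge0.
have DP2 x : sqrt_op D (P2 x) = sqrt_op D x.
  by rewrite [in RHS](proj_split pA x) (bopD _ _ bD2) D1 add0r.
have P2D x : P2 (sqrt_op D x) = sqrt_op D x.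
  apply: inner_ext => z.
  by rewrite (proj2_sym pA) !(psd_sym _ _ pD2) DP2.
split=> //; last by rewrite psd_adj// sqrt_sqr.
by split=> //; apply/funext => x; rewrite /block /= P2D DP2.
Qed.

Lemma MopE K L M N : block_factors A B K L M ->
  Mop A B N = M + adj (L + N) + M22 A B N.
Proof.
by move=> bf; rewrite /Mop (block11_self pA) (bf_pinvM bf) (bf_pinvL bf).
Qed.

Lemma M22P N : admissible A B N ->
  op_between (Htwo A) (Htwo A) (M22 A B N) /\
  M22 A B N \o adj (M22 A B N) = schur B A - (adj N \o N).
Proof.
move=> aN; have [bN _ N2 _] := admissible_block aN.
have [_ _ lN] := aN; rewrite /M22; case: xgetP => // h.
have [h1 h2 _ _] := residual_sqrt bN N2 lN.
by case: (h _ (conj h1 h2)).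
Qed.

Lemma M22_block N : admissible A B N -> [/\ bounded_op (M22 A B N),
  forall x, P2 (M22 A B N x) = M22 A B N x &
  forall x, M22 A B N (P2 x) = M22 A B N x].
Proof.
move=> /M22P[[bM EM] _].
have E x : M22 A B N x = P2 (M22 A B N (P2 x)) by rewrite {1}EM.
by split=> // x; [rewrite E (proj22 pA)|rewrite E (proj22 pA) -E].
Qed.

Lemma residual_norm N M2 x : bounded_op N -> bounded_op M2 ->
  M2 \o adj M2 = schur B A - (adj N \o N) ->
  '[adj M2 x, adj M2 x] = '[schur B A x, x] - '[N x, N x].
Proof.
move=> bN bM2 E; rewrite (bop_comp_adj_le bM2 E).
rewrite [LHS](_ : _ = '[schur B A x - adj N (N x), x])//.
by rewrite innerBl (adjP' bN).
Qed.

Lemma Mop_spec N : admissible A B N ->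
  [/\ bounded_op (Mop A B N), Mop A B N \o adj (Mop A B N) = B &
      forall x, A2 (Mop A B N x) = C x].
Proof.
move=> aN; have [bN N1 N2 CN] := admissible_block aN.
have [bM2 M21 M22'] := M22_block aN; have [_ EM2] := M22P aN.
have [K [L [M bf]]] := block_factors_exist pA pB.
have M2N x := residual_norm x bN bM2 EM2.
rewrite (MopE _ bf); split.
- exact: (bop_completion bf bN bM2).
- exact: (completion_comp_adj pA pB bf bN bM2).
- exact: (sqrt_completion pA bf bN).
Qed.

Lemma schur_proj1 x : schur B A (P1 x) = 0.
Proof.
have [K [L [M bf]]] := block_factors_exist pA pB.
apply: psd_eq0; first exact: (psd_schur pA pB bf).
have := psd_ge0 (P1 x) (psd_schur pA pB bf).
rewrite (schur_inner pA bf) (proj21 pA) (bop0 (psd_bop pB)) inner0l.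
by have := inner_ge0 (K (P1 x)); lra.
Qed.

Lemma optimal_coupling_exists : exists Y : H -> H,
  [/\ bounded_op Y, Y \o adj Y = B, psd_op (A2 \o Y), psd_op (schur B A) &
      forall x, A2 x = 0 -> Y x = sqrt_op (schur B A) x].
Proof.
have [K [L [M bf]]] := block_factors_exist pA pB.
have pC := psd_core pA pB; have bA2 := psd_bop (psd_sqrt pA).
have pS := psd_schur pA pB bf.
have b0 := @bop_cst0 R H.
have c1 := bop0 (bop_proj1 pA); have c0 : C 0 = 0 := bop0 (psd_bop pC).
have E0 : schur B A - (adj (0 : H -> H) \o 0) = schur B A.
  apply/funext => x; rewrite [LHS](_ : _ = schur B A x - adj (0 : H -> H) 0)//.
  by rewrite (bop0 (bop_adj b0)) subr0.
have [||[bM2 _] EM2 M21 M22'] := residual_sqrt (N := 0) b0 => //; first by rewrite E0.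
rewrite E0 in bM2 EM2 M21 M22'.
have M2N x := residual_norm x b0 bM2 (etrans EM2 (esym E0)).
pose Y := M + adj (L + 0) + sqrt_op (schur B A).
have A2Y x : A2 (Y x) = C x by apply: (sqrt_completion pA bf b0).
exists Y; split=> //.
- exact: (bop_completion bf b0 bM2).
- by apply: (completion_comp_adj pA pB bf b0 bM2).
- by suff -> : A2 \o Y = C by []; apply/funext.
- move=> x Ax; rewrite [Y x](_ : _ = M x + adj (L + 0) x + sqrt_op (schur B A) x)//.
  have -> : M x = 0.
    apply: (bf_Mnull bf); apply/(null_core pA pB); rewrite Ax.
    exact/bop0/psd_bop/psd_sqrt/psd_block11.
  rewrite addr0 add0r [X in X + _](_ : _ = 0) ?add0r//.
  apply: inner_ext => z; rewrite (adjP' (bf_bL bf)) inner0l innerC.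
  apply: (inner_proj12 pA); first exact: bf_proj1L bf z.
  exact/(null_sqrt_Htwo pA).
Qed.

Section FromCoupling.
Variables YA YB : H -> H.
Hypotheses (bYA : bounded_op YA) (bYB : bounded_op YB).
Hypotheses (EA : YA \o adj YA = A) (EB : YB \o adj YB = B).
Hypothesis pAB : psd_op (adj YA \o YB).

(** [YB \o V] plays the role of YB in coordinates where YA becomes A^(1/2). [Mop] is matched only on
    the range of [A2], where [M22] vanishes; this is the cross product that determines the path. *)
Lemma admissible_of_coupling : exists N, admissible A B N /\
  forall x, Mop A B N (A2 x) = YB (adj YA x).
Proof.
have [K [L [M bf]]] := block_factors_exist pA pB.
have pA2 := psd_sqrt pA; have bA2 := psd_bop pA2.
have [bYA' bYB'] := (bop_adj bYA, bop_adj bYB).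
have [b1 b2] := (bop_proj1 pA, bop_proj2 pA).
have pC := psd_core pA pB.
have [V pV] : exists V, partial_isometry (adj YA) A2 V.
  apply: partial_isometry_exists => // u.
  by rewrite sqrt_inner// (bop_comp_adj_le bYA EA).
have bV := pi_bop pV; have bV' := bop_adj bV.
have VA x : V (A2 x) = adj YA x := pi_fwd pV x.
have VVA x : adj V (V (A2 x)) = A2 x by rewrite VA (pi_bwd pV).
have YAV x : YA (V x) = A2 x.
  apply: inner_ext => z; rewrite (adjP bYA) (adjP bV) (pi_bwd pV).
  by rewrite (psd_sym _ _ pA2).
have YBA x : adj YB (YA x) = adj YA (YB x).
  by apply: inner_ext => z; rewrite (adjP' bYB) (adjP bYA) -(psd_sym _ _ pAB).
(* By symmetry of YA^* YB, the vector YB^* A^(1/2) z is YA^* YB V z. It lies in the range of V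
   A^(1/2), where V V^* is the identity. *)
have AYB y : A2 (YB (V (adj V y))) = A2 (YB y).
  apply: inner_ext => z; rewrite !(psd_sym _ _ pA2) !(adjP bYB) -YAV YBA -VA.
  by rewrite (adjP bV) VVA (adjP' bV).
have AYBV y : A2 (YB (V y)) = C y.
  have bYV := bop_comp bYB bV.
  have pZ : psd_op (A2 \o (YB \o V)).
    have := psd_conj pAB bV; congr psd_op; apply/funext => x.
    by rewrite /= -VA VVA.
  have Zadj x : (A2 \o (YB \o V)) x = adj V (adj YB (A2 x)).
    rewrite -[in LHS](psd_adj pZ) (adj_compE bA2 bYV) (psd_adj pA2) /=.
    by rewrite (adj_compE bYB bV).
  have -> : C = A2 \o (YB \o V); last by [].
  (* The operator is V^* (YA^* YB) V, hence positive; by [AYB] its square is A^(1/2) B A^(1/2), so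
     it is the positive root [C]. *)
  apply: psd_sqr_inj => //; apply/funext => x /=.
  have -> : A2 (YB (V x)) = adj V (adj YB (A2 x)) by exact: Zadj.
  rewrite AYB -[YB _]/((YB \o adj YB) _) EB.
  rewrite (coreE pA) -[LHS]/((sqrt_op _ \o sqrt_op _) x) sqrt_sqr.
    by rewrite /block11 /block /= (sqrt_proj1 pA) (proj1_sqrt pA).
  exact/psd_conj_sqrt/psd_block11.
have PM x : M x = P1 (YB (V x)).
  rewrite -(bf_pinvM bf); suff -> : pinv A2 \o C = P1 \o (YB \o V) by [].
  apply: (pinv_comp bA2) => u; first by rewrite /= (sqrt_proj1 pA) AYBV.
  rewrite null_sqrt// => z; rewrite -[null A]/(Htwo A) => hz.
  apply: (inner_proj12 pA); first exact: proj11.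
  exact: (proj_id (csub_Htwo pA)).
have P1V x : P1 (adj V x) = adj V x.
  apply: inner_ext => z; rewrite (proj1_sym pA) !(adjP' bV); congr '[_, _].
  rewrite [in RHS](proj_split pA z) (bopD _ _ bV) [X in _ = _ + X](_ : _ = 0) ?addr0//.
  apply: (pi_eq0 pV); rewrite -null_psd_orth//; exact: sqrt_proj2.
(* The adjoint of [J] is [P2 \o YB \o V], the lower left block that [Mop] has to reproduce. *)
pose J := adj V \o (adj YB \o P2).
have bJ : bounded_op J by apply: bop_comp => //; apply: bop_comp.
pose N := J - L; have bL := bf_bL bf.
have NE x : N x = J x - L x by [].
have JE : L + N = J by apply/funext => x; rewrite addrfctE NE addrC subrK.
have bN : bounded_op N by exact: bop_sub.
have CN x : C (N x) = 0.
  rewrite NE (bopB _ _ (psd_bop pC)) (bf_coreL bf) /J /= -AYBV AYB.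
  by rewrite -[YB _]/((YB \o adj YB) _) EB subrr.
have N1 x : P1 (N x) = N x.
  by rewrite NE (bopB _ _ b1) /J /= P1V (bf_proj1L bf).
have N2 x : N (P2 x) = N x by rewrite !NE /J /= (proj22 pA) (bf_Lproj2 bf).
clearbody N.
have aN : admissible A B N.
  split.
  - by split=> //; apply/funext => x; rewrite /block /= N1 N2.
  - by move=> _ [x _ <-]; rewrite /null /= (block11_self pA); exact/(null_core pA pB).
  - have pS := psd_schur pA pB bf; have pN := psd_adj_comp bN.
    split; first exact: bop_sub (psd_bop pS) (psd_bop pN).
    + move=> x y; rewrite [LHS](_ : _ = '[schur B A x - (adj N \o N) x, y])//.
      rewrite [RHS](_ : _ = '[x, schur B A y - (adj N \o N) y])//.
      by rewrite innerBl innerBr (psd_sym _ _ pS) (psd_sym _ _ pN).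
    + move=> x; rewrite [leRHS](_ : _ = '[schur B A x - adj N (N x), x])//.
      rewrite innerBl (adjP' bN) (schur_inner pA bf) -(bf_KL bf).
      (* [L x] and [N x] are orthogonal with sum [J x], so bounding [J] by the form of [B] on
         [Htwo A] bounds [N] by what [L] leaves over, which is the Schur complement. *)
      have : '[J x, J x] <= '[B (P2 x), P2 x].
        apply: le_trans (pi_adj_le pV _) _.
        by rewrite /= (bop_comp_adj_le bYB EB).
      rewrite -JE addrfctE !innerE (innerC (N x) (L x)) (bf_Lorth bf _ (CN x)); lra.
exists N; split=> // x; have [bM2 _ M2P] := M22_block aN.
rewrite (MopE _ bf) JE.
rewrite [LHS](_ : _ = M (A2 x) + adj J (A2 x) + M22 A B N (A2 x))//.
rewrite -M2P (proj2_sqrt pA) (bop0 bM2) addr0 PM VA.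
have -> : adj J (A2 x) = P2 (YB (V (A2 x))).
  by apply: inner_ext => z; rewrite (adjP' bJ) /= -(adjP bV) -(adjP bYB) (proj2_sym pA).
by rewrite VA -(proj_split pA).
Qed.

End FromCoupling.
End Pair.
End AdmissibleOperators.

(** * Geodesics and barycenters *)

Section Geodesics.
Context {R : realType} {H : hilbertType R}.
Implicit Types (x y z u v w : H) (A B S T X Y L Z N : H -> H) (r s t : R).

Lemma B1plus_sqrt A : B1plus A -> [/\ bounded_op (sqrt_op A),
  hilbert_schmidt (sqrt_op A) & sqrt_op A \o adj (sqrt_op A) = A].
Proof.
move=> hA; have pA := hA.1; have pA2 := psd_sqrt pA; have bA2 := psd_bop pA2.
have E : sqrt_op A \o adj (sqrt_op A) = A by rewrite psd_adj// sqrt_sqr.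
by split=> //; apply: hs_of_B1plus; rewrite ?E.
Qed.

Lemma optimal_coupling A B : B1plus A -> B1plus B -> exists Y : H -> H,
  [/\ bounded_op Y, hilbert_schmidt Y, Y \o adj Y = B,
      W2sq A B = hs_norm2 (sqrt_op A - Y) & psd_op (schur B A) /\
      forall x, sqrt_op A x = 0 -> Y x = sqrt_op (schur B A) x].
Proof.
move=> hA hB; have [bA2 hA2 EA] := B1plus_sqrt hA.
have [Y [bY EY pY pS hY]] := optimal_coupling_exists hA.1 hB.1.
have hsY : hilbert_schmidt Y by apply: hs_of_B1plus; rewrite ?EY.
exists Y; split=> //; rewrite -{1}EA -{1}EY.
apply: W2sq_psd_coupling => //; rewrite psd_adj//; exact: psd_sqrt hA.1.
Qed.

Lemma hs_norm2_subC X Y : hs_norm2 (X - Y) = hs_norm2 (Y - X).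
Proof.
congr onb_fsum; apply/funext => e; rewrite /hs_summand.
rewrite [(X - Y) e](_ : _ = X e - Y e)// [(Y - X) e](_ : _ = Y e - X e)//.
by rewrite -opprB innerNl innerNr opprK.
Qed.

Lemma W2sq_le_coupling_of A B X Y : bounded_op X -> bounded_op Y ->
  hilbert_schmidt X -> hilbert_schmidt Y -> X \o adj X = A -> Y \o adj Y = B ->
  W2sq A B <= hs_norm2 (X - Y).
Proof. by move=> bX bY hX hY <- <-; exact: W2sq_le_coupling. Qed.

(** An optimal coupling in one order is a competitor in the other, which gives both inequalities. *)
Lemma W2sq_sym A B : B1plus A -> B1plus B -> W2sq A B = W2sq B A.
Proof.
suff h A' B' : B1plus A' -> B1plus B' -> W2sq A' B' <= W2sq B' A'.
  by move=> hA hB; apply/eqP; rewrite eq_le !h.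
move=> hA hB; have [bB2 hB2 EB] := B1plus_sqrt hB.
have [Y [bY hY EY -> _]] := optimal_coupling hB hA.
by rewrite hs_norm2_subC; exact: W2sq_le_coupling_of.
Qed.

Lemma W2sq_ge0 A B : B1plus A -> B1plus B -> 0 <= W2sq A B.
Proof.
move=> hA hB; have [Y [_ _ _ -> _]] := optimal_coupling hA hB.
exact: hs_norm2_ge0.
Qed.

(** [Num.sqrt] is 0 on negative numbers, so recovering the square rests on [W2sq_ge0]. *)
Lemma W2sqE A B : B1plus A -> B1plus B -> W2sq A B = W2 A B ^+ 2.
Proof. by move=> hA hB; rewrite sqr_sqrtr// W2sq_ge0. Qed.

Lemma hs_stewart X Y Z r : 0 <= r <= 1 -> hilbert_schmidt X ->
  hilbert_schmidt Y -> hilbert_schmidt Z ->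
  (1 - r) * hs_norm2 (Z - X) + r * hs_norm2 (Z - Y) =
  hs_norm2 (Z - ((1 - r) *: X + r *: Y)) + r * (1 - r) * hs_norm2 (X - Y).
Proof.
move=> /andP[r0 r1] hX hY hZ.
have r1' : 0 <= 1 - r by rewrite subr_ge0.
have h1 := hs_sub hZ hX; have h2 := hs_sub hZ hY; have h3 := hs_sub hX hY.
have h4 : hilbert_schmidt (Z - ((1 - r) *: X + r *: Y)).
  by apply: hs_sub => //; apply: hs_add; exact: hs_scale.
have h3' := onb_summableZ (mulr_ge0 r0 r1') h3.
rewrite -!onb_fsumZ ?mulr_ge0// -!onb_fsumD//; try exact: onb_summableZ.
congr onb_fsum; apply/funext => e; rewrite /hs_summand.
rewrite [(Z - X) e](_ : _ = Z e - X e)// [(Z - Y) e](_ : _ = Z e - Y e)//.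
rewrite [(X - Y) e](_ : _ = X e - Y e)//.
rewrite [(Z - _) e](_ : _ = Z e - ((1 - r) *: X e + r *: Y e))//.
rewrite !innerE (innerC (X e) (Z e)) (innerC (Y e) (Z e)) (innerC (Y e) (X e)).
by ring.
Qed.

(** Rigidity in Stewart's identity: the hypothesis leaves no room for the squared distance from [Z]
    to the point of the segment. *)
Lemma interpolation X Y Z r : 0 <= r <= 1 -> bounded_op X -> bounded_op Y ->
  bounded_op Z -> hilbert_schmidt X -> hilbert_schmidt Y -> hilbert_schmidt Z ->
  (1 - r) * hs_norm2 (Z - X) + r * hs_norm2 (Z - Y) <=
    r * (1 - r) * hs_norm2 (X - Y) ->
  Z = (1 - r) *: X + r *: Y.
Proof.
move=> r01 bX bY bZ hX hY hZ; rewrite hs_stewart// gerDr => h.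
have bW : bounded_op ((1 - r) *: X + r *: Y) by apply: bop_add; exact: bop_scale.
have hW : hilbert_schmidt ((1 - r) *: X + r *: Y) by apply: hs_add; exact: hs_scale.
apply/eqP; rewrite -subr_eq0; apply/eqP/hs_norm2_eq0.
- exact: bop_sub.
- exact: hs_sub.
- by apply/eqP; rewrite eq_le h hs_norm2_ge0.
Qed.

(** The two mixed terms have the same quadratic form, so one cross product suffices to determine the
    curve. *)
Lemma segment_comp_adj_eq X Y X' Y' t : bounded_op X -> bounded_op Y ->
  bounded_op X' -> bounded_op Y' ->
  X \o adj X = X' \o adj X' -> Y \o adj Y = Y' \o adj Y' ->
  Y \o adj X = Y' \o adj X' ->
  ((1 - t) *: X + t *: Y) \o adj ((1 - t) *: X + t *: Y) =
  ((1 - t) *: X' + t *: Y') \o adj ((1 - t) *: X' + t *: Y').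
Proof.
have E Z W : bounded_op Z -> bounded_op W -> forall x,
    '[(((1 - t) *: Z + t *: W) \o adj ((1 - t) *: Z + t *: W)) x, x] =
    (1 - t) ^+ 2 * '[(Z \o adj Z) x, x] + 2 * (1 - t) * t * '[(W \o adj Z) x, x]
    + t ^+ 2 * '[(W \o adj W) x, x].
  move=> bZ bW x; have bZW := bop_add (bop_scale (1 - t) bZ) (bop_scale t bW).
  rewrite /= (adjP bZW) !(adjP bZ) !(adjP bW).
  rewrite (adj_addE (bop_scale (1 - t) bZ) (bop_scale t bW)).
  rewrite (adj_scaleE _ bZ) (adj_scaleE _ bW) addrfctE !scalrfctE !innerE.
  by rewrite (innerC (adj W x) (adj Z x)); ring.
move=> bX bY bX' bY' EX EY EXY.
have p1 := psd_comp_adj (bop_add (bop_scale (1 - t) bX) (bop_scale t bY)).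
have p2 := psd_comp_adj (bop_add (bop_scale (1 - t) bX') (bop_scale t bY')).
apply: quad_ext; [exact: psd_bop|exact: psd_bop|by case: p1|by case: p2|].
by move=> x; rewrite !E// EX EY EXY.
Qed.

Lemma segment_geodesic A B M : B1plus A -> B1plus B -> bounded_op M ->
  M \o adj M = B -> psd_op (sqrt_op A \o M) ->
  constant_speed_geodesic A B (fun t =>
    ((1 - t) *: sqrt_op A + t *: M) \o adj ((1 - t) *: sqrt_op A + t *: M)).
Proof.
move=> hA hB bM EM pC.
have [bA2 hA2 EA] := B1plus_sqrt hA; have pA2 := psd_sqrt hA.1.
have hM : hilbert_schmidt M by apply: hs_of_B1plus; rewrite ?EM.
pose G t := (1 - t) *: sqrt_op A + t *: M.
have GE t x : G t x = (1 - t) *: sqrt_op A x + t *: M x by [].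
have bG t : bounded_op (G t) by apply: bop_add; exact: bop_scale.
have hG t : hilbert_schmidt (G t) by apply: hs_add; exact: hs_scale.
have A2M x y : '[sqrt_op A x, M y] = '[(sqrt_op A \o M) x, y].
  by rewrite (psd_sym _ _ pA2) (psd_sym _ _ pC).
have MA2 x y : '[M x, sqrt_op A y] = '[(sqrt_op A \o M) x, y].
  by rewrite -(psd_sym _ _ pA2).
(* For [s] and [t] in the unit interval all three coefficients are nonnegative and multiply positive
   forms; symmetry of [sqrt_op A \o M] merges the mixed terms. *)
have GG s t x y : '[G t x, G s y] = (1 - t) * (1 - s) * '[sqrt_op A x, sqrt_op A y]
    + ((1 - t) * s + t * (1 - s)) * '[(sqrt_op A \o M) x, y]
    + t * s * '[M x, M y].
  by rewrite !GE !innerE A2M MA2; ring.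
have W s t : 0 <= s <= 1 -> 0 <= t <= 1 ->
    W2sq (G s \o adj (G s)) (G t \o adj (G t)) =
    (s - t) ^+ 2 * hs_norm2 (sqrt_op A - M).
  move=> /andP[s0 s1] /andP[t0 t1]; rewrite W2sq_psd_coupling//.
    have -> : G s - G t = (t - s) *: (sqrt_op A - M).
      apply/funext => x; rewrite [LHS](_ : _ = G s x - G t x)// !GE.
      rewrite [RHS](_ : _ = (t - s) *: (sqrt_op A x - M x))//.
      by apply: inner_ext => z; rewrite !innerE; ring.
    by rewrite hs_norm2_scale; [congr (_ * _); ring | exact: hs_sub].
  have s1' : 0 <= 1 - s by rewrite subr_ge0.
  have t1' : 0 <= 1 - t by rewrite subr_ge0.
  split.
  - by apply: bop_comp => //; exact: bop_adj.
  - move=> x y /=; rewrite (adjP' (bG s)) innerC [RHS]innerC (adjP' (bG s)).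
    rewrite innerC !GG (innerC (sqrt_op A x)) (innerC (M x)) (psd_sym _ _ pC).
    by rewrite (innerC x).
  - move=> x; have hC := psd_ge0 x pC; rewrite /= (adjP' (bG s)) GG.
    apply: addr_ge0; last by rewrite !mulr_ge0// inner_ge0.
    apply: addr_ge0; first by rewrite !mulr_ge0// inner_ge0.
    by apply: mulr_ge0 hC; apply: addr_ge0; exact: mulr_ge0.
have G0 : G 0 = sqrt_op A.
  by apply/funext => x; rewrite GE subr0 scale1r scale0r addr0.
have G1 : G 1 = M.
  by apply/funext => x; rewrite GE subrr scale0r scale1r add0r.
split.
- move=> t _; exact: B1plus_comp_adj (bG t) (hG t).
- by rewrite -/(G 0) G0.
- by rewrite -/(G 1) G1.
- move=> s t hs ht; rewrite /W2 -/(G s) -/(G t) W//.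
  have := W 0 1; rewrite G0 G1 EA EM !lexx ler01 => -> //.
  by rewrite sqrtrM ?sqr_ge0// sqrtr_sqr sub0r sqrrN expr1n mul1r.
Qed.

(** The midpoint of [a] and [b] also divides the segment from [y] to [b] at parameter [r]. After
    multiplication by 2 (1 - t) the coefficient of [y] is 1. *)
Lemma extend_right (a b y r t : R) : r * (1 - t) = 2^-1 - t ->
  (1 - 2^-1) * a + 2^-1 * b = (1 - r) * y + r * b -> y = (1 - t) * a + t * b.
Proof.
move=> rE E.
have := congr1 (fun k => 2 * (1 - t) * k) E.
have := congr1 (fun k => 2 * k * y) rE; have := congr1 (fun k => 2 * k * b) rE.
by rewrite /=; lra.
Qed.

Lemma extend_left (a b y r t : R) : r * t = 2^-1 ->
  (1 - 2^-1) * a + 2^-1 * b = (1 - r) * a + r * y -> y = (1 - t) * a + t * b.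
Proof.
move=> rE E.
have := congr1 (fun k => 2 * t * k) E.
have := congr1 (fun k => 2 * k * y) rE; have := congr1 (fun k => 2 * k * a) rE.
by rewrite /=; lra.
Qed.

Section Endpoints.
Variables A B : H -> H.
Hypotheses (hA : B1plus A) (hB : B1plus B).
Let pA : psd_op A := hA.1.
Let pB : psd_op B := hB.1.

Lemma GammaN_geodesic N : admissible A B N ->
  constant_speed_geodesic A B (GammaN A B N).
Proof.
move=> aN; have [bM EM AM] := Mop_spec pA pB aN.
apply: segment_geodesic => //.
suff -> : sqrt_op A \o Mop A B N = core A B by exact: psd_core.
exact/funext.
Qed.

Lemma barycenter_schur t G : 0 < t < 1 -> barycenters A B t G ->
  schur A G = 0 /\ schur B G = 0.
Proof.
move=> /andP[t0 t1] [hG minG].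
have t1' : 0 < 1 - t by rewrite subr_gt0.
have t01 : 0 <= t <= 1 by rewrite !ltW.
have [bS hS ES] := B1plus_sqrt hG.
have [YA [bYA hYA EA WA [pSA YAE]]] := optimal_coupling hG hA.
have [YB [bYB hYB EB WB [pSB YBE]]] := optimal_coupling hG hB.
pose Z := (1 - t) *: YA + t *: YB.
have bZ : bounded_op Z by apply: bop_add; exact: bop_scale.
have hZ : hilbert_schmidt Z by apply: hs_add; exact: hs_scale.
have SZ : sqrt_op G = Z.
  apply: interpolation => //.
  (* At [G] the objective is exactly the weighted sum of squared distances from [sqrt_op G] to [YA]
     and [YB]. At Z Z^* it is at most the same sum taken from [Z], which Stewart's identity
     evaluates to t (1 - t) |YA - YB|^2. *)
  have := minG _ (B1plus_comp_adj bZ hZ) => /=.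
  rewrite (W2sq_sym hA hG) (W2sq_sym hB hG) WA WB => h; apply: le_trans h _.
  have := hs_stewart t01 hYA hYB hZ.
  rewrite -/Z subrr (_ : hs_norm2 0 = 0) ?add0r; last first.
    have := hs_norm2_scale 0 hZ; rewrite scale0r expr0n mul0r //.
  move=> <-; rewrite !(hs_norm2_subC Z).
  apply: lerD; rewrite ler_wpM2l ?(ltW t1') ?(ltW t0)//; exact: W2sq_le_coupling_of.
have null0 x : sqrt_op G x = 0 ->
    schur A G x = 0 /\ schur B G x = 0.
  move=> Gx; have := congr1 (fun f : H -> H => '[f x, x]) SZ.
  rewrite /= Gx inner0l [Z x](_ : _ = (1 - t) *: YA x + t *: YB x)//.
  rewrite innerDl !innerZl YAE// YBE// => h.
  have qA := psd_sqrt pSA; have qB := psd_sqrt pSB.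
  have hA0 := psd_ge0 x qA; have hB0 := psd_ge0 x qB.
  have hA1 := mulr_ge0 (ltW t1') hA0; have hB1 := mulr_ge0 (ltW t0) hB0.
  have : (1 - t) * '[sqrt_op (schur A G) x, x] +
      t * '[sqrt_op (schur B G) x, x] == 0 by rewrite -h.
  rewrite paddr_eq0// => /andP[/eqP eA /eqP eB].
  have sA : sqrt_op (schur A G) x = 0.
    apply: psd_eq0 => //; apply/eqP; move/eqP: eA.
    by rewrite mulf_eq0 gt_eqF.
  have sB : sqrt_op (schur B G) x = 0.
    apply: psd_eq0 => //; apply/eqP; move/eqP: eB.
    by rewrite mulf_eq0 gt_eqF.
  by rewrite -(sqrtK x pSA) -(sqrtK x pSB) sA sB !bop0//; exact: psd_bop.
have pG := hG.1; split; apply/funext => x; rewrite (proj_split pG x).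
- rewrite (bopD _ _ (psd_bop pSA)) (schur_proj1 pG pA) add0r.
  by have [] := null0 _ (sqrt_proj2 pG x).
- rewrite (bopD _ _ (psd_bop pSB)) (schur_proj1 pG pB) add0r.
  by have [] := null0 _ (sqrt_proj2 pG x).
Qed.

Lemma geodesic_GammaN (G : R -> H -> H) : constant_speed_geodesic A B G ->
  exists N, admissible A B N /\ forall t, 0 <= t <= 1 -> G t = GammaN A B N t.
Proof.
move=> [hG G0 G1 Gd]; pose w := W2 A B.
have h01 : 0 <= (2^-1 : R) <= 1 by apply/andP; split; lra.
have GW s t : 0 <= s <= 1 -> 0 <= t <= 1 -> W2sq (G s) (G t) = (s - t) ^+ 2 * w ^+ 2.
  move=> hs ht; rewrite W2sqE; [|exact: hG|exact: hG].
  by rewrite Gd// exprMn real_normK ?num_real.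
pose S := G 2^-1; have hS : B1plus S := hG _ h01.
have [bS2 hS2 ES] := B1plus_sqrt hS.
have [YA [bYA hYA EA WA _]] := optimal_coupling hS hA.
have [YB [bYB hYB EB WB _]] := optimal_coupling hS hB.
have SA : W2sq S A = 4^-1 * w ^+ 2.
  by rewrite -G0 GW ?lexx ?ler01//; field.
have SB : W2sq S B = 4^-1 * w ^+ 2.
  by rewrite -G1 GW ?lexx ?ler01//; field.
have WAB : W2sq A B = w ^+ 2 by rewrite W2sqE.
have leAB : w ^+ 2 <= hs_norm2 (YA - YB).
  by rewrite -WAB; exact: W2sq_le_coupling_of.
(* The weighted sum of squared distances is w^2 / 4, and |YA - YB|^2 / 4 is at least that, because
   [YA] and [YB] couple [A] and [B]. *)
have mid : sqrt_op S = (1 - 2^-1) *: YA + 2^-1 *: YB.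
  by apply: interpolation => //; rewrite -WA -WB SA SB; lra.
(* Stewart's identity at the midpoint gives |YA - YB|^2 = w^2, so this coupling is optimal. *)
have pAB : psd_op (adj YA \o YB).
  apply: psd_of_optimal_coupling => //; rewrite EA EB WAB.
  have := hs_stewart h01 hYA hYB hS2; rewrite -mid subrr -WA -WB SA SB.
  rewrite (_ : hs_norm2 0 = 0); last first.
    by have := hs_norm2_scale 0 hS2; rewrite scale0r expr0n mul0r.
  by lra.
have GE t : 0 <= t <= 1 ->
    G t = ((1 - t) *: YA + t *: YB) \o adj ((1 - t) *: YA + t *: YB).
  move=> t01; have /andP[t0 t1] := t01.
  have [Y [bY hY EY WY _]] := optimal_coupling hS (hG t t01).
  rewrite -EY; suff -> : Y = (1 - t) *: YA + t *: YB by [].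
  have YW : hs_norm2 (sqrt_op S - Y) = (2^-1 - t) ^+ 2 * w ^+ 2.
    by rewrite -WY GW.
  (* The midpoint lies between [G t] and [B] in the first case and between [A] and [G t] in the
     second; [r] is its parameter on that segment, whose length is (1 - t) w or t w. *)
  have [tlt|tge] := ltP t 2^-1.
  - have t1' : 0 < 1 - t by lra.
    pose r := (2^-1 - t) / (1 - t).
    have rE : r * (1 - t) = 2^-1 - t by rewrite /r divfK ?gt_eqF.
    have r01 : 0 <= r <= 1.
      by rewrite /r divr_ge0 ?(ltW t1')//= ?ler_pdivrMr// ?mul1r; lra.
    have : sqrt_op S = (1 - r) *: Y + r *: YB.
      apply: interpolation => //; rewrite YW -WB SB.
      have : (t - 1) ^+ 2 * w ^+ 2 <= hs_norm2 (Y - YB).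
        rewrite -GW ?lexx ?ler01// G1.
        exact: W2sq_le_coupling_of.
      have /andP[r0 r1] := r01.
      have r1' : 0 <= 1 - r by rewrite subr_ge0.
      move/(ler_wpM2l (mulr_ge0 r0 r1')); apply: le_trans.
      rewrite le_eqVlt; apply/orP; left; apply/eqP.
      by rewrite /r; field; rewrite gt_eqF.
    rewrite mid => E; apply/funext => x; apply: inner_ext => z.
    have := congr1 (fun f : H -> H => '[f x, z]) E.
    rewrite !addrfctE !scalrfctE !innerE; exact: extend_right rE.
  - have t0' : 0 < t by lra.
    pose r := 2^-1 / t.
    have rE : r * t = 2^-1 by rewrite /r divfK ?gt_eqF.
    have r01 : 0 <= r <= 1.
      by rewrite /r divr_ge0 ?(ltW t0')//= ?ler_pdivrMr// ?mul1r; lra.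
    have : sqrt_op S = (1 - r) *: YA + r *: Y.
      apply: interpolation => //; rewrite YW -WA SA.
      have : (0 - t) ^+ 2 * w ^+ 2 <= hs_norm2 (YA - Y).
        rewrite -GW ?lexx ?ler01// G0.
        exact: W2sq_le_coupling_of.
      have /andP[r0 r1] := r01.
      have r1' : 0 <= 1 - r by rewrite subr_ge0.
      move/(ler_wpM2l (mulr_ge0 r0 r1')); apply: le_trans.
      rewrite le_eqVlt; apply/orP; left; apply/eqP.
      by rewrite /r; field; rewrite gt_eqF.
    rewrite mid => E; apply/funext => x; apply: inner_ext => z.
    have := congr1 (fun f : H -> H => '[f x, z]) E.
    rewrite !addrfctE !scalrfctE !innerE; exact: extend_left rE.
have [N [aN MN]] := admissible_of_coupling pA pB bYA bYB EA EB pAB.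
exists N; split=> // t t01; rewrite GE//.
have [bM EM _] := Mop_spec pA pB aN; have [bA2 _ EA2] := B1plus_sqrt hA.
apply: segment_comp_adj_eq => //; first by rewrite EA EA2.
  by rewrite EB EM.
apply/funext => x; rewrite /= (psd_adj (psd_sqrt pA)) MN//.
Qed.
End Endpoints.
End Geodesics.

Theorem theorem6p11 (R : realType) (H : hilbertType R) (A B : H -> H)
    (sepH : separable H) (hA : B1plus A) (hB : B1plus B)
    (hAB : reachable A B) :
  [/\ forall N : H -> H, admissible A B N ->
        constant_speed_geodesic A B (GammaN A B N),
      forall (t : R) (G : H -> H), 0 < t < 1 -> barycenters A B t G ->
        schur A G = 0 /\ schur B G = 0
    & forall G : R -> H -> H, constant_speed_geodesic A B G ->
        exists N : H -> H, admissible A B N /\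
          forall t : R, 0 <= t <= 1 -> G t = GammaN A B N t].
Proof.
split.
- by move=> N; exact: GammaN_geodesic.
- by move=> t G; exact: barycenter_schur.
- by move=> G; exact: geodesic_GammaN.
Qed.
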